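(* Let $T\sim\{X_n\}_{n=1}^\infty$, $\Gamma=\operatorname{essran}X_1$, $\Gamma_1=\Gamma\setminus\{0\}$, and let $A$ be a unilateral weighted shift with nonnegative weights $\{a_i\}_{i=1}^\infty$. (i) If $0\in\Gamma$, then $\mathbb P(A\lhd T)=1$ if $\Sigma_1(A)\subset\Gamma$, and $\mathbb P(A\lhd T)=0$ if $\Sigma_1(A)\nsubseteq\Gamma$. (ii) If $0\notin\Gamma$, then $\mathbb P(A\lhd T)=1$ if $\operatorname{card}\Gamma=1$ and $\Sigma_1(A)=\Gamma$, and $\mathbb P(A\lhd T)=0$ otherwise. (iii) If $0\notin\Gamma$ or $0$ is an accumulation point of $\Gamma$, then $T\lhd A$ a.s. if and only if $\{0\}\times\Gamma^n\subset\Sigma_{n+1}(A)$ for all $n\ge1$. (iv) If $0$ is an isolated point of $\Gamma$, then $T\lhd A$ a.s. if and only if one of the following three holds: (a) $a_1=0$ and $\{0\}\times\Gamma_1^n\times\{0\}\subset\Sigma_{n+2}(A)$ for all $n\ge1$; (b) $a_1\ne0$ and $\{0\}\times\Gamma_1^n\times\{0\}\subset\Sigma_{n+2}(A)$ for all $n\ge0$; (c) there exists $m\ge1$ such that $(a_1,\dots,a_{m+1})\in\Gamma_1^m\times\{0\}$, $\{0\}\times\big[\Gamma_1^m\setminus\{(a_1,\dots,a_m)\}\big]\times\{0\}\subset\Sigma_{m+2}(A)$, and $\{0\}\times\Gamma_1^n\times\{0\}\subset\Sigma_{n+2}(A)$ for all $n\ge0$, $n\ne m$.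
   Context: $\mathcal H$ is a complex separable infinite-dimensional Hilbert space with orthonormal basis $\{e_n\}_{n=1}^\infty$. $\{X_n\}_{n=1}^\infty$ are nonnegative, bounded, i.i.d. random variables on a probability space $(\Omega,\mathcal F,\mathbb P)$. Writing $T\sim\{X_n\}_{n=1}^\infty$ means that $T=T(\omega)$ is the random unilateral weighted shift $T(\omega)e_n=X_n(\omega)e_{n+1}$, $n\ge1$. $\operatorname{essran}X_1$ is the essential range of $X_1$ (the closed support of its law), and $\operatorname{card}$ denotes cardinality. The operator $A$ is deterministic: a unilateral weighted shift $A$ with weights $\{a_i\}_{i=1}^\infty$ acts by $Af_i=a_if_{i+1}$ ($i\ge1$) on an orthonormal basis $\{f_i\}_{i=1}^\infty$ of a Hilbert space, with $\{a_i\}$ bounded. Its $n$-spectrum ($n\ge1$) is $$\Sigma_n(A)=\text{closure in }\mathbb R^n\text{ of }\{(|a_i|,|a_{i+1}|,\dots,|a_{i+n-1}|):i\ge1\}.$$ For $n=0$, $\{0\}\times\Gamma_1^0\times\{0\}=\{(0,0)\}$. For Hilbert space operators $A,B$, $A\lhd B$ means $\|p(A,A^* )\|\le\|p(B,B^* )\|$ for all polynomials $p(x,y)$ in two free (noncommuting) variables with complex coefficients (constant terms allowed).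
   Formalization: Part (iii) additionally assumes that it is not the case that card Γ = 1 and Σ_1(A) = Γ; in that case (Γ = {c}, c > 0, all a_i = c) T ◁ A a.s. but (0,c) is not in Σ_2(A), so the printed equivalence fails. *)

(* Defs.v *)
From HB Require Import structures.
From mathcomp Require Import all_boot all_order all_algebra.
From mathcomp Require Import finmap complex monalg.
From mathcomp Require Import all_classical all_reals all_analysis.

Set Implicit Arguments.
Unset Strict Implicit.
Unset Printing Implicit Defensive.

Import Order.TTheory GRing.Theory Num.Theory.
Import numFieldNormedType.Exports.

Local Open Scope classical_set_scope.
Local Open Scope ring_scope.
Local Open Scope complex_scope.

(* Throughout, sequences indexed by n >= 1 on paper are indexed from 0:
   [e n], [a n], [X n] stand for e_{n+1}, a_{n+1}, X_{n+1}. *)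

(* [dot] is linear in its first argument. *)
HB.mixin Record isHilbert (R : realType) H of CompleteNormedModule R[i] H := {
  dot : H -> H -> R[i];
  dotDl : forall x y z : H, dot (x + y) z = dot x z + dot y z;
  dotZl : forall (c : R[i]) (x y : H), dot (c *: x) y = c * dot x y;
  dotC : forall x y : H, dot y x = (dot x y)^*;
  dotxx : forall x : H, dot x x = `|x| ^+ 2
}.

#[short(type="hilbertType")]
HB.structure Definition Hilbert (R : realType) :=
  {H of isHilbert R H & CompleteNormedModule R[i] H}.

Definition linear_span (R : realType) (H : hilbertType R) (e : nat -> H) :
    set H :=
  [set x | exists (n : nat) (c : nat -> R[i]), x = \sum_(i < n) c i *: e i].

(* An orthonormal basis indexed by nat exists exactly when the space is
   separable and infinite-dimensional. *)
Definition orthonormal_basis (R : realType) (H : hilbertType R)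
    (e : nat -> H) : Prop :=
  (forall i j : nat, dot (e i) (e j) = (i == j)%:R) /\
  closure (linear_span e) = [set: H].

Definition bounded_operator (R : realType) (H : hilbertType R) (T : H -> H) :
    Prop :=
  linear T /\ exists M : R, forall x : H, `|T x| <= M%:C * `|x|.

Definition weighted_shift (R : realType) (H : hilbertType R) (e : nat -> H)
    (w : nat -> R) (T : H -> H) : Prop :=
  bounded_operator T /\ forall n : nat, T (e n) = (w n)%:C *: e n.+1.

(* [adjoint T y] is the vector z with <T x, y> = <x, z> for all x; it exists
   and is unique when [T] is a bounded operator. *)
Definition adjoint (R : realType) (H : hilbertType R) (T : H -> H) : H -> H :=
  fun y => xget 0 [set z | forall x : H, dot (T x) y = dot x z].

(* The operator norm, as a real number; norms of vectors take values in [R[i]],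
   whence the real part. *)
Definition opnorm (R : realType) (H : hilbertType R) (S : H -> H) : R :=
  sup [set complex.Re `|S x| | x in [set x : H | `|x| <= 1]].

(* Polynomials in two free variables x, y: the monoid algebra over R[i] of the
   free monoid on two letters, [false] standing for x and [true] for y. *)
Definition ncpoly (R : realType) := {malg R[i][{fmonom bool}]}.

Definition word_eval (H : Type) (A B : H -> H) (w : seq bool) : H -> H :=
  fun v => foldr (fun (b : bool) u => if b then B u else A u) v w.

Definition ncpoly_eval (R : realType) (H : hilbertType R) (p : ncpoly R)
    (A B : H -> H) : H -> H :=
  fun v => \sum_(w <- msupp p) p@_w *: word_eval A B (fmonom_val w) v.

Definition lhd_op (R : realType) (K H : hilbertType R)
    (A : K -> K) (B : H -> H) : Prop :=
  forall p : ncpoly R,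
    opnorm (ncpoly_eval p A (adjoint A)) <= opnorm (ncpoly_eval p B (adjoint B)).

Definition window (R : realType) (a : nat -> R) (i n : nat) : 'rV[R]_n :=
  \row_(j < n) a (i + j)%N.

Definition n_spectrum (R : realType) (a : nat -> R) (n : nat) : set 'rV[R]_n :=
  closure [set window (fun k => `|a k|) i n | i in [set: nat]].

Arguments n_spectrum {R} a n _.

(* The Cartesian power S^n; for n = 1 it is S seen as a subset of R^1. *)
Definition row_power (R : realType) (S : set R) (n : nat) : set 'rV[R]_n :=
  [set v | forall j : 'I_n, S (v 0 j)].

Arguments row_power {R} S n _.

Definition row_prod (R : realType) (m n : nat)
    (U : set 'rV[R]_m) (V : set 'rV[R]_n) : set 'rV[R]_(m + n) :=
  [set row_mx u v | u in U & v in V].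

Definition row_zero (R : realType) : set 'rV[R]_1 := [set 0].
Arguments row_zero {R} _.

Definition mutually_independent d (Omega : measurableType d) (R : realType)
    (P : probability Omega R) (X : nat -> {RV P >-> R}) : Prop :=
  forall (J : seq nat) (B : nat -> set R),
    uniq J -> (forall j, measurable (B j)) ->
    P (\bigcap_(j in [set` J]) (X j @^-1` B j)) =
    (\prod_(j <- J) P (X j @^-1` B j))%E.

Definition identically_distributed d (Omega : measurableType d) (R : realType)
    (P : probability Omega R) (X : nat -> {RV P >-> R}) : Prop :=
  forall (n : nat) (B : set R), measurable B ->
    distribution P (X n) B = distribution P (X 0%N) B.

Definition iid d (Omega : measurableType d) (R : realType)
    (P : probability Omega R) (X : nat -> {RV P >-> R}) : Prop :=
  mutually_independent X /\ identically_distributed X.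

Definition essran d (Omega : measurableType d) (R : realType)
    (P : probability Omega R) (X : {RV P >-> R}) : set R :=
  [set x | forall U : set R, open U -> U x -> (0 < distribution P X U)%E].

(* Main.v *)
Require Import Defs.
From mathcomp Require Import all_boot all_order all_algebra.
From mathcomp Require Import finmap complex monalg.
From mathcomp Require Import all_classical all_reals all_analysis.
From mathcomp Require Import ring lra zify.

(** A polynomial in a weighted shift and its adjoint acts on finitely supported
coordinate vectors by an explicit formula in the weights, and these vectors are
dense. Hence for shifts [A] and [T] with weights [a] and [x] the relation
[lhd_op A T], written [A <| T] here, depends on the two weight sequences only
([lhd_coord_dominates]).

The theorem rests on a description of this relation by windows,
[lhd_block_matches]. Cut [a] at its zeros; a block starts at index 0 or just
after a zero. [A <| T] holds exactly when every finite piece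
[a_s, ..., a_(s+n-1)] that begins where a block begins and is nonzero except
possibly in its last entry satisfies one of two conditions:
- it is a limit of windows of [x] each of which is preceded by a weight that
  tends to 0 ([window_limit]), or
- it is the beginning of [x].

Sufficiency: [A] is the direct sum of its compressions to blocks, so it is
enough to test vectors supported in one block. Such a vector is moved to the
place where [x] imitates the block; the result of any fixed word differs little
from the moved result, because the small weight in front of the window prevents
the adjoint from leaking out of it ([sqnorm_approx_le], [block_induction]).

Necessity: the polynomial
[M - T T^* - sum_k T^*^k (T^* T - a_(s+k)^2)^2 T^k] is diagonal in the basis.
For [A] its entry at [s] is [M], so for [T] some entry must come close to [M], and
then the weights around that entry are close to those of the piece
([coord_dominates_defect], [defect_small]). The first basis vector of [T] has no
weight in front of it, which is the source of the second alternative.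

Now let [x] be the random sequence [X]. Almost surely its entries lie in the
essential range [Gamma] ([ae_essran]), every finite pattern in [Gamma] is
approximated by windows arbitrarily far out ([iid_window_ae]), and every finite
pattern in [Gamma] is approximated with positive probability by the first
entries ([iid_rectangle_ae]).
- For [A <| T] with 0 in [Gamma], patterns preceded by 0 occur as soon as all
  [a_i] lie in [Gamma]. With 0 outside [Gamma] no weight of [T] is small, only
  the second alternative survives, and it forces [X = a], a null event unless
  [Gamma] is a point to which all [a_i] are equal.
- For [T <| A], a pattern can be perturbed so that it is not the beginning of
  [a]; then the first alternative holds for it, and limits of windows are closed
  ([window_limit_of_ae_match]). Perturbation fails only if [Gamma] is a single
  nonzero point to which all [a_i] are equal. If 0 is isolated in [Gamma] then
  [X] breaks up into finite blocks closed by zeros, and the exceptional pattern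
  is the one block with which [A] itself begins; in the last claim it is
  empty in case (a), has length [m] in case (c), and gets no exemption in (b).

The window description consists of countably many conditions on the entries of
[X], so the events in question are measurable. *)

Set Implicit Arguments.
Unset Strict Implicit.
Unset Printing Implicit Defensive.

Import Order.TTheory GRing.Theory Num.Theory.
Import numFieldNormedType.Exports.

Local Open Scope classical_set_scope.
Local Open Scope ring_scope.
Local Open Scope complex_scope.

(** * Coordinates of polynomials in a shift and its adjoint *)

Section coordinates.
Variable F : numFieldType.
Implicit Types (w x b : nat -> F) (c : nat -> F) (u v : seq bool).

(** Coordinates of [T x] and of [T^* x] for the shift [T] with weights [w], when
[c] are the coordinates of [x]. *)
Definition shift_act w c n : F := if n is m.+1 then w m * c m else 0.
Definition adjoint_act w c n : F := w n * c n.+1.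
Definition word_act w u c : nat -> F :=
  word_eval (shift_act w) (adjoint_act w) u c.
Definition poly_act w (l : seq (F * seq bool)) c n : F :=
  \sum_(t <- l) t.1 * word_act w t.2 c n.
Definition supp_below N c := forall n, (N <= n)%N -> c n = 0.
Definition sqnorm N c : F := \sum_(n < N) `|c n| ^+ 2.
Definition translate j c n : F := if (n < j)%N then 0 else c (n - j)%N.

Lemma translateD j c n : translate j c (j + n) = c n.
Proof. by rewrite /translate ltnNge leq_addr /= addKn. Qed.

Lemma word_act_cons w h u c :
  word_act w (h :: u) c =
  (if h then adjoint_act w else shift_act w) (word_act w u c).
Proof. by case: h. Qed.

Lemma supp_below_word_act w u c N :
  supp_below N c -> supp_below (N + size u) (word_act w u c).
Proof.
move=> cN; elim: u => [|h u IH] n; first by rewrite addn0 => /cN.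
rewrite word_act_cons /= addnS => nN; case: h.
  by rewrite /adjoint_act IH ?mulr0// (leq_trans (ltnW nN)).
by case: n nN => // n nN; rewrite /shift_act IH ?mulr0.
Qed.

(** A zero weight disconnects the basis: the shift cannot cross it upwards. *)
Lemma word_act_barrier w u c L : supp_below L.+1 c -> w L = 0 ->
  supp_below L.+1 (word_act w u c).
Proof.
move=> cL wL; elim: u => [//|h u IH] [//|n].
rewrite ltnS leq_eqVlt word_act_cons.
case: h; rewrite /adjoint_act /shift_act /=.
  by move=> nL; rewrite IH ?mulr0// ltnW// ltnS leq_eqVlt.
by case/predU1P => [<-|/IH ->]; rewrite ?wL ?mul0r ?mulr0.
Qed.

Lemma word_act_bound w u c (M B : F) : 0 <= M -> (forall i, `|w i| <= M) ->
  (forall i, `|c i| <= B) -> forall n, `|word_act w u c n| <= M ^+ size u * B.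
Proof.
move=> M0 wM cB; elim: u => [|h u IH] n; first by rewrite expr0 mul1r.
have B0 : 0 <= B by apply: le_trans (cB 0%N).
rewrite word_act_cons /= exprS -mulrA; case: h; rewrite /adjoint_act /shift_act.
  by rewrite normrM ler_pM.
case: n => [|n]; first by rewrite normr0 mulr_ge0// mulr_ge0// exprn_ge0.
by rewrite normrM ler_pM.
Qed.

(** If [x] and the window of [b] at [j] have close weights wherever the orbit of
[c] under [x] lives, then moving [c] to [j] almost commutes with words. The
adjoint could push the moved vector below [j]; the weight [b j.-1] that it would
use is small. The constant [K] depends neither on [b] nor on [j], so that the
window may be chosen after the accuracy. *)
Lemma word_act_approx x u c (M B : F) : 0 <= M -> (forall i, `|x i| <= M) ->
  (forall i, `|c i| <= B) ->
  exists2 K, 0 <= K & forall b j L (eps : F), 0 <= eps ->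
    (forall i, `|b i| <= M) ->
    (forall v, (size v <= size u)%N -> supp_below L (word_act x v c)) ->
    (j = 0%N \/ `|b j.-1| <= eps) ->
    (forall i, (i < L)%N -> `|x i - b (j + i)%N| <= eps) ->
    forall n, `|word_act b u (translate j c) n - translate j (word_act x u c) n|
      <= K * eps.
Proof.
move=> M0 xM cB; have B0 : 0 <= B by apply: le_trans (cB 0%N).
elim: u => [|h u [K K0 IH]].
  by exists 0 => // b j L eps eps0 _ _ _ _ n; rewrite subrr normr0 mul0r.
pose B' := M ^+ size u * B.
have B'0 : 0 <= B' by rewrite mulr_ge0 ?exprn_ge0.
have uB' := word_act_bound u M0 xM cB.
exists (M * K + B') => [|b j L eps eps0 bM suppL bj xb n].
  by rewrite addr_ge0// mulr_ge0.
have {}IH n' := IH b j L eps eps0 bM (fun v vs => suppL v (leqW vs)) bj xb n'.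
have uL : supp_below L (word_act x u c) by apply: suppL => /=.
(* one more letter multiplies the previous error by a weight and adds the effect
   of replacing that weight *)
have step p q (i : nat) y : `|p - translate j (word_act x u c) q| <= K * eps ->
    `|b i * translate j (word_act x u c) q - y| <= B' * eps ->
    `|b i * p - y| <= (M * K + B') * eps.
  move=> h1 h2.
  have -> : b i * p - y = b i * (p - translate j (word_act x u c) q) +
    (b i * translate j (word_act x u c) q - y) by ring.
  rewrite mulrDl (le_trans (ler_normD _ _))// lerD// normrM -mulrA.
  by rewrite ler_pM.
have wt i k : (i <= k)%N ->
    `|b (j + i)%N * word_act x u c k - x i * word_act x u c k| <= B' * eps.
  move=> ik; rewrite -mulrBl normrM distrC mulrC.
  have [iL|Li] := ltnP i L; first by rewrite ler_pM// xb.
  by rewrite (uL k (leq_trans Li ik)) normr0 mul0r mulr_ge0.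
rewrite !word_act_cons; case: h suppL => suppL; rewrite /adjoint_act /shift_act.
  apply: step (IH n.+1) _; rewrite {1 2}/translate.
  have [nj|jn] := ltnP n j; last first.
    rewrite ltnNge (leqW jn) /= subSn//.
    by have := wt (n - j)%N (n - j).+1 (leqnSn _); rewrite subnKC.
  rewrite subr0 ltn_neqAle nj andbT; case: eqP => [jE|_] /=; last first.
    by rewrite mulr0 normr0 mulr_ge0.
  rewrite -jE subnn normrM mulrC ler_pM//.
  by case: bj; rewrite -jE.
case: n => [|n].
  rewrite /translate; case: j {bj xb IH step wt} => [|j] /=;
  by rewrite subr0 normr0 mulr_ge0// addr_ge0// mulr_ge0.
apply: step (IH n) _; rewrite /translate.
have [nj|jn] := ltnP n j; last first.
  rewrite ltnNge (leqW jn) /= subSn//.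
  by have := wt (n - j)%N _ (leqnn _); rewrite subnKC.
rewrite mulr0 sub0r normrN; case: ltnP => [_|jn].
  by rewrite normr0 mulr_ge0.
have -> : (n.+1 - j = 0)%N by apply/eqP; rewrite subn_eq0.
by rewrite normr0 mulr_ge0.
Qed.

Lemma poly_act_approx x (l : seq (F * seq bool)) c (M B : F) :
  0 <= M -> (forall i, `|x i| <= M) -> (forall i, `|c i| <= B) ->
  exists2 K, 0 <= K & forall b j L (eps : F), 0 <= eps ->
    (forall i, `|b i| <= M) ->
    (forall t, t \in l -> forall v, (size v <= size t.2)%N ->
       supp_below L (word_act x v c)) ->
    (j = 0%N \/ `|b j.-1| <= eps) ->
    (forall i, (i < L)%N -> `|x i - b (j + i)%N| <= eps) ->
    forall n, `|poly_act b l (translate j c) (j + n) - poly_act x l c n| <= K * eps.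
Proof.
move=> M0 xM cB; elim: l => [|t l [K K0 IH]].
  exists 0 => // b j L eps eps0 _ _ _ _ n.
  by rewrite /poly_act !big_nil subrr normr0 mul0r.
have [K' K'0 H] := word_act_approx t.2 M0 xM cB.
exists (`|t.1| * K' + K) => [|b j L eps eps0 bM suppL bj xb n].
  by rewrite addr_ge0// mulr_ge0.
rewrite /poly_act !big_cons opprD addrACA -mulrBr mulrDl.
rewrite (le_trans (ler_normD _ _))// lerD//; last first.
  apply: (IH b j L) => // t' t'l; apply: suppL; by rewrite inE t'l orbT.
rewrite normrM -mulrA ler_wpM2l//.
have := H b j L eps eps0 bM _ bj xb (j + n)%N.
by rewrite translateD; apply; apply: suppL; rewrite mem_head.
Qed.

Lemma poly_act_bound w l c (M B : F) : 0 <= M -> (forall i, `|w i| <= M) ->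
  (forall i, `|c i| <= B) ->
  exists2 B', 0 <= B' & forall n, `|poly_act w l c n| <= B'.
Proof.
move=> M0 wM cB; have B0 : 0 <= B by apply: le_trans (cB 0%N).
exists (\sum_(t <- l) `|t.1| * (M ^+ size t.2 * B)) => [|n].
  by apply: sumr_ge0 => t _; rewrite !mulr_ge0// exprn_ge0.
rewrite (le_trans (ler_norm_sum _ _ _))// ler_sum// => t _.
by rewrite normrM ler_wpM2l// word_act_bound.
Qed.

Lemma supp_below_bound N c : supp_below N c ->
  exists2 B, 0 <= B & forall n, `|c n| <= B.
Proof.
move=> cN; exists (\sum_(i < N) `|c i|) => [|n]; first exact: sumr_ge0.
have [nN|/cN ->] := ltnP n N; last by rewrite normr0 sumr_ge0.
by rewrite (bigD1 (Ordinal nN))//= lerDl sumr_ge0.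
Qed.

Lemma sqnorm_translate j N c : sqnorm (j + N) (translate j c) = sqnorm N c.
Proof.
rewrite /sqnorm big_split_ord /= big1 ?add0r.
  by apply: eq_bigr => i _; rewrite translateD.
by move=> i _; rewrite /translate ltn_ord normr0 expr0n.
Qed.

Lemma sqnorm_drop j N c : \sum_(i < N) `|c (j + i)%N| ^+ 2 <= sqnorm (j + N) c.
Proof.
rewrite /sqnorm big_split_ord /= lerDr.
by apply: sumr_ge0 => i _; rewrite exprn_ge0.
Qed.

Lemma sqnorm_widen N N' c : (N <= N')%N -> sqnorm N c <= sqnorm N' c.
Proof.
move=> /subnKC <-; rewrite /sqnorm big_split_ord /= lerDl.
by apply: sumr_ge0 => i _; rewrite exprn_ge0.
Qed.

(** Norm bounds pass to limits of windows: by [poly_act_approx] the vector [c],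
moved to a good window of [x], realises the value for [a] up to an error that
tends to 0. *)
Lemma sqnorm_approx_le x l r N c (a : nat -> F) L (M : F) : 0 <= M ->
  (forall i, `|x i| <= M) -> (forall i, `|a i| <= M) ->
  (forall N c, supp_below N c ->
     forall N', sqnorm N' (poly_act x l c) <= r * sqnorm N c) ->
  supp_below N c ->
  (forall t, t \in l -> forall v, (size v <= size t.2)%N ->
     supp_below L (word_act a v c)) ->
  (forall eps, 0 < eps -> exists2 j, j = 0%N \/ `|x j.-1| <= eps &
     forall i, (i < L)%N -> `|a i - x (j + i)%N| <= eps) ->
  forall N', sqnorm N' (poly_act a l c) <= r * sqnorm N c.
Proof.
move=> M0 xM aM xr cN supp win N'.
have [B B0 cB] := supp_below_bound cN.
have [K K0 HK] := poly_act_approx l M0 aM cB.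
have [B' B'0 HB'] := poly_act_bound l M0 aM cB.
pose D := K * (B' + (B' + K)).
have D0 : 0 <= D by rewrite mulr_ge0// !addr_ge0.
have small eps : 0 < eps -> eps <= 1 ->
    sqnorm N' (poly_act a l c) <= r * sqnorm N c + D * eps *+ N'.
  move=> e0 e1; have [j bj xb] := win _ e0.
  have H := HK x j L eps (ltW e0) xM supp bj xb.
  have cjN : supp_below (j + N) (translate j c).
    move=> n jN; rewrite /translate ltnNge (leq_trans (leq_addr N j) jN) /=.
    by rewrite cN// leq_subRL// (leq_trans (leq_addr N j) jN).
  have := xr _ _ cjN (j + N')%N; rewrite sqnorm_translate.
  move=> /(le_trans (sqnorm_drop _ _ _)) h; apply: le_trans (lerD h (lexx _)).
  have -> : D * eps *+ N' = \sum_(i < N') D * eps by rewrite sumr_const card_ord.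
  rewrite -big_split /= ler_sum// => i _.
  have {}H := H i.
  set p := poly_act a l c i in H *; set q := poly_act x _ _ _ in H *.
  have pB : `|p| <= B' by apply: HB'.
  have pq : `|p| <= `|q| + K * eps.
    rewrite -lerBlDl; apply: le_trans H; rewrite distrC.
    exact: lerB_dist.
  have qB : `|q| <= B' + K.
    have -> : q = p + (q - p) by ring.
    rewrite (le_trans (ler_normD _ _))// lerD// (le_trans H)// -[leRHS]mulr1.
    by rewrite ler_wpM2l.
  have -> : `|p| ^+ 2 = `|q| ^+ 2 + (`|p| - `|q|) * (`|p| + `|q|) by ring.
  rewrite lerD2l /D mulrAC.
  have s0 : 0 <= `|p| + `|q| by rewrite addr_ge0.
  apply: le_trans (_ : K * eps * (`|p| + `|q|) <= _).
    by rewrite ler_wpM2r// lerBlDl.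
  by rewrite ler_wpM2l ?mulr_ge0 ?(ltW e0)// lerD.
(* eps is at most 1 and makes the error at most e *)
apply/ler_addgt0Pr => e e0.
have N0 : 0 < D *+ N' + e by rewrite ltr_wpDl// mulrn_wge0.
pose eps := e / (D *+ N' + e).
have eps0 : 0 < eps by rewrite divr_gt0.
have eps1 : eps <= 1 by rewrite ler_pdivrMr// mul1r lerDr mulrn_wge0.
rewrite (le_trans (small _ eps0 eps1))// lerD2l -mulrnAl /eps mulrCA.
by rewrite ger_pMr// ler_pdivrMr// mul1r lerDl ltW.
Qed.

End coordinates.

(** * Cutting at zero weights and a diagonal polynomial *)

Section split.
Variable F : numFieldType.
Implicit Types (w x b : nat -> F) (c : nat -> F) (u v : seq bool).

Lemma word_actD w u c c1 c2 : (forall n, c n = c1 n + c2 n) ->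
  forall n, word_act w u c n = word_act w u c1 n + word_act w u c2 n.
Proof.
move=> cE; elim: u => [//|h u IH] n; rewrite !word_act_cons; case: h.
  by rewrite /adjoint_act IH mulrDr.
by case: n => [|n]; rewrite /shift_act ?addr0// IH mulrDr.
Qed.

Lemma poly_actD w l c c1 c2 : (forall n, c n = c1 n + c2 n) ->
  forall n, poly_act w l c n = poly_act w l c1 n + poly_act w l c2 n.
Proof.
move=> cE n; rewrite /poly_act -big_split; apply: eq_bigr => t _.
by rewrite (word_actD _ _ cE) mulrDr.
Qed.

Lemma word_act_translate w u c s : s = 0%N \/ w s.-1 = 0 -> forall n,
  word_act w u (translate s c) n =
  translate s (word_act (fun i => w (s + i)%N) u c) n.
Proof.
move=> ws; elim: u => [//|h u IH] n; rewrite !word_act_cons; case: h.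
  rewrite /adjoint_act IH /translate.
  have [ns|sn] := ltnP n s; last by rewrite ltnNge (leqW sn) /= subnKC// subSn.
  case: ltnP => [_|sn]; first by rewrite mulr0.
  have sE : s = n.+1 by lia.
  by case: ws => [|]; rewrite sE//= => ->; rewrite mul0r.
case: n => [|n]; first by rewrite /translate; case: s ws {IH}.
rewrite /shift_act IH /translate.
have [ns|sn] := ltnP n s; last by rewrite ltnNge leqW//= subSn//= subnKC.
rewrite mulr0; case: ltnP => // sn.
by have -> : (n.+1 - s = 0)%N by lia.
Qed.

Lemma poly_act_translate w l c s : s = 0%N \/ w s.-1 = 0 -> forall n,
  poly_act w l (translate s c) n =
  translate s (poly_act (fun i => w (s + i)%N) l c) n.
Proof.
move=> ws n; rewrite /poly_act {2}/translate.
case: ltnP => sn; last first.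
  apply: eq_bigr => t _; rewrite word_act_translate// /translate ltnNge sn//.
by rewrite big1// => t _; rewrite word_act_translate// /translate sn mulr0.
Qed.

(** Scanning downwards from [N] to the nearest zero weight finds the block to
which the index [N.-1] belongs. *)
Lemma last_block_start w N : exists s, [/\ s = 0%N \/ w s.-1 = 0,
  s = 0%N \/ (s < N)%N & forall i, (s <= i)%N -> (i.+1 < N)%N -> w i != 0].
Proof.
elim: N => [|[|N] [s [h1 h2 h3]]]; [by exists 0%N; split=> //; left| |].
  by exists 0%N; split=> //; left.
have [wN|wN] := eqVneq (w N) 0.
  by exists N.+1; split; [right|right|move=> i; lia].
exists s; split => //; first by case: h2 => h; [left|right; lia].
move=> i si; rewrite ltnS leq_eqVlt => /predU1P[[->]//|]; exact: h3.
Qed.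

(** A shift is the orthogonal sum of its compressions to blocks. Splitting off
the last block met by the support of [c], one block at a time, reduces a norm
bound to vectors supported in a single block. *)
Lemma block_induction w l r :
  (forall s n c, s = 0%N \/ w s.-1 = 0 ->
     (forall i, (i.+1 < n)%N -> w (s + i)%N != 0) -> supp_below n c ->
     forall N', sqnorm N' (poly_act (fun i => w (s + i)%N) l c)
       <= r * sqnorm n c) ->
  forall N c, supp_below N c ->
  forall N', sqnorm N' (poly_act w l c) <= r * sqnorm N c.
Proof.
move=> H N; elim/ltn_ind: N => N IH c cN N'.
have [s [ws sN sw]] := last_block_start w N.
have [s0|s0] := eqVneq s 0%N.
  have := H 0%N N c (or_introl erefl).
  rewrite (_ : (fun i => w (0 + i)%N) = w); last exact/funext.
  by apply=> // i; apply: sw; rewrite s0.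
case: s s0 ws sN sw => // s _ [//|ws] [//|sN] sw.
pose c1 n := if (n < s.+1)%N then c n else 0.
pose c2 n := c (s.+1 + n)%N.
have cE n : c n = c1 n + translate s.+1 c2 n.
  rewrite /c1 /translate /c2; case: ltnP => h; rewrite ?addr0 ?add0r//.
  by rewrite subnKC.
have c1s : supp_below s.+1 c1 by move=> n sn; rewrite /c1 ltnNge sn.
have c2N : supp_below (N - s.+1) c2 by move=> n h; apply: cN; lia.
have h1 := IH _ sN _ c1s s.+1.
have h2 : sqnorm N' (poly_act (fun i => w (s.+1 + i)%N) l c2)
    <= r * sqnorm (N - s.+1) c2.
  apply: H => //; first by right.
  by move=> i h; apply: sw; lia.
have -> : sqnorm N c = sqnorm s.+1 c1 + sqnorm (N - s.+1) c2.
  rewrite -[in LHS](subnKC (ltnW sN)) /sqnorm big_split_ord /=; congr (_ + _).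
  by apply: eq_bigr => i _; rewrite /c1 ltn_ord.
rewrite mulrDr; apply: le_trans (lerD h1 h2).
apply: le_trans (_ : sqnorm (s.+1 + N') (poly_act w l c) <= _).
  by rewrite sqnorm_widen// leq_addl.
have p1 : supp_below s.+1 (poly_act w l c1).
  move=> n sn; rewrite /poly_act big1// => t _.
  by rewrite (word_act_barrier t.2 c1s ws sn) mulr0.
have pE := poly_actD w l cE.
rewrite /sqnorm big_split_ord /= lerD// ler_sum// => i _;
  rewrite pE poly_act_translate; [|by right|..|by right].
  by rewrite /translate ltn_ord addr0.
by rewrite p1 ?leq_addr// add0r translateD.
Qed.

Lemma word_act_cat w u v c : word_act w (u ++ v) c = word_act w u (word_act w v c).
Proof. by rewrite /word_act /word_eval foldr_cat. Qed.

Lemma word_act_nseq_true w k c i : word_act w (nseq k true) c i =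
  (\prod_(m < k) w (i + m)%N) * c (i + k)%N.
Proof.
elim: k i => [|k IH] i; first by rewrite big_ord0 mul1r addn0.
rewrite [nseq _ _]/= word_act_cons /adjoint_act IH big_ord_recl addn0 mulrA addSnnS.
by congr (_ * _ * _); apply: eq_bigr => m _; rewrite addSnnS.
Qed.

Lemma word_act_nseq_false w k c i : word_act w (nseq k false) c (i + k)%N =
  (\prod_(m < k) w (i + m)%N) * c i.
Proof.
elim: k => [|k IH]; first by rewrite big_ord0 mul1r addn0.
rewrite [nseq _ _]/= word_act_cons addnS /shift_act IH big_ord_recr /= mulrA.
by rewrite [_ * w _]mulrC.
Qed.

(** The diagonal entry at [i] of
[T T^* + sum_k T^*^k (T^* T - g_k)^2 T^k]: it vanishes exactly when the weight
before [i] is 0 and the squared weights from [i] on follow [g] up to the first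
zero weight, included. At [i = 0] there is no preceding weight. *)
Definition defect w (g : nat -> F) n i : F :=
  (if i is j.+1 then w j else 0) ^+ 2 +
  \sum_(k < n) (\prod_(m < k) w (i + m)%N) ^+ 2 * (w (i + k)%N ^+ 2 - g k) ^+ 2.

(** The letters [false] and [true] stand for the operator and its adjoint; the
square [(T^* T - g_k)^2] is expanded into three words. *)
Definition defect_poly (M : F) (g : nat -> F) n : seq (F * seq bool) :=
  [:: (M, [::]); (-1, [:: false; true])] ++
  flatten [seq
  [:: (- 1, nseq k true ++ [:: true; false; true; false] ++ nseq k false);
     (g k *+ 2, nseq k true ++ [:: true; false] ++ nseq k false);
     (- g k ^+ 2, nseq k true ++ nseq k false)] | k <- iota 0 n].

Lemma poly_act_defect w M g n c i :
  poly_act w (defect_poly M g n) c i = (M - defect w g n i) * c i.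
Proof.
rewrite /poly_act big_cat /= !big_cons big_nil big_flatten big_map /=.
rewrite -[X in iota 0 X]subn0 -/(index_iota 0 n) big_mkord.
rewrite /defect opprD [M + _]addrA [RHS]mulrDl addr0; congr (_ + _).
  rewrite /= /word_act /= [RHS]mulrDl; congr (_ + _).
  case: i => [|i]; rewrite /shift_act /adjoint_act.
    by rewrite mulr0 expr0n/= oppr0 mul0r.
  by rewrite mulN1r mulNr mulrA.
rewrite mulNr mulr_suml -sumrN; apply: eq_bigr => k _.
rewrite !big_cons big_nil !word_act_cat !word_act_nseq_true !word_act_cons /=.
rewrite /adjoint_act /shift_act word_act_nseq_false.
ring.
Qed.

End split.

(** * Domination of weight sequences described by windows *)

Section domination.
Variable R : realType.
Implicit Types (a x w : nat -> R) (l : seq (R[i] * seq bool)).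

Definition weightsC w : nat -> R[i] := fun i => (w i)%:C.

(** The norm of the polynomial [l] in the shift with weights [w] is at most [r].
The bound [N'] is free, so that no length of the image has to be recorded. *)
Definition coord_norm_le w l (r : R) := forall N c, supp_below N c ->
  forall N', sqnorm N' (poly_act (weightsC w) l c) <= (r ^+ 2)%:C * sqnorm N c.

Definition coord_dominates a x :=
  forall l r, 0 <= r -> coord_norm_le x l r -> coord_norm_le a l r.

Definition window_limit x n (v : nat -> R) :=
  forall eps, 0 < eps -> exists j, `|x j| < eps /\
    forall i, (i < n)%N -> `|x (j.+1 + i)%N - v i| < eps.

Definition block_match a s n x :=
  window_limit x n (fun i => a (s + i)%N) \/
  (forall i, (i < n)%N -> x i = a (s + i)%N).

(** The last entry is left free because it may be the zero that closes the block;
this zero is part of what has to be imitated. *)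
Definition block_prefix a s n := (s = 0%N \/ a s.-1 = 0) /\
  forall i, (i.+1 < n)%N -> a (s + i)%N != 0.

Definition block_matches a x :=
  forall s n, block_prefix a s n -> block_match a s n x.

Lemma normcR (t : R) : `|t%:C| = `|t|%:C :> R[i].
Proof. by rewrite normc_def /= expr0n/= addr0 sqrtr_sqr. Qed.

Lemma weightsC_bound w M i : (forall i, `|w i| <= M) -> `|weightsC w i| <= M%:C.
Proof. by rewrite normcR lecR. Qed.

Lemma block_match_window a s n x : block_match a s n x ->
  forall eps : R[i], 0 < eps -> exists2 j, j = 0%N \/ `|weightsC x j.-1| <= eps &
    forall i, (i < n)%N -> `|weightsC a (s + i)%N - weightsC x (j + i)%N| <= eps.
Proof.
move=> m eps eps0.
have epsE : (complex.Re eps)%:C = eps by rewrite RRe_real// gtr0_real.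
have {}eps0 : 0 < complex.Re eps by rewrite -ltcR epsE.
case: m => [/(_ _ eps0)[j [xj H]]|H].
  exists j.+1; first by right; rewrite normcR -epsE lecR ltW.
  move=> i /H; rewrite /weightsC -rmorphB normcR -epsE lecR distrC => /ltW.
  by rewrite addSn.
exists 0%N; [by left|move=> i /H; rewrite /weightsC => ->].
by rewrite subrr normr0 -epsE lecR ltW.
Qed.

(** By [block_induction] it is enough to treat [c] supported in one block. Words
of length at most [d] see only the piece of the block that ends at its closing
zero, or [d] places beyond the support of [c] if there is no such zero nearby;
that piece matches [x]. *)
Lemma block_matches_coord_dominates a x M :
  (forall i, `|a i| <= M) -> (forall i, `|x i| <= M) ->
  block_matches a x -> coord_dominates a x.
Proof.
move=> aM xM H l r r0 xr.
have M0 : 0 <= M by apply: le_trans (aM 0%N).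
have M0C : 0 <= M%:C by rewrite lecR.
apply: block_induction => s D c sa aD cD.
pose a' i := weightsC a (s + i)%N.
pose d := \max_(t <- l) size t.2.
have dP t : t \in l -> (size t.2 <= d)%N.
  by move=> tl; apply: (@leq_bigmax_seq _ _ xpredT).
have Da i : (i.+1 < D)%N -> a (s + i)%N != 0.
  by move=> /aD; rewrite /weightsC -[0]/(0%:C) (inj_eq (@complexI _)).
have aC : s = 0%N \/ a s.-1 = 0.
  by case: sa => h; [left|right; apply: (@complexI _)].
suff [L [La Ls]] : exists L, (forall i, (i.+1 < L)%N -> a (s + i)%N != 0) /\
    forall v, (size v <= d)%N -> supp_below L (word_act a' v c).
  apply: (sqnorm_approx_le M0C (fun i => weightsC_bound i xM)
    (fun i => weightsC_bound (s + i) aM) xr cD).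
    by move=> t tl v vt; apply: Ls; apply: leq_trans vt (dP _ tl).
  by apply: block_match_window; apply: H.
have [[k kP]|nk] := pselect (exists k, (D <= k.+1)%N && (a (s + k)%N == 0)).
  (* the piece ends at the first zero weight that is met after the support *)
  have := ex_minnP (ex_intro (fun k => _ && _) k kP).
  move=> -[{kP}k /andP[Dk /eqP ak] kmin].
  exists k.+1; split=> [i|v _].
    rewrite ltnS => ik; have [|Di] := ltnP i.+1 D; first exact: Da.
    apply/negP => ai; have := kmin i; rewrite Di ai => /(_ isT).
    by rewrite leqNgt ik.
  apply: word_act_barrier; last by rewrite /a' /weightsC ak.
  by move=> n kn; apply: cD; apply: leq_trans kn.
(* there is no zero to stop the words, but they move the support by at most d *)
exists (D + d)%N; split=> [i _|v vd n Dn].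
  have [|Di] := ltnP i.+1 D; first exact: Da.
  by apply/negP => ai; apply: nk; exists i; rewrite Di ai.
by apply: (supp_below_word_act _ cD); apply: leq_trans Dn; rewrite leq_add2l.
Qed.

(** The norm of a diagonal operator is the supremum of its entries. *)
Lemma coord_norm_le_diag w l (D : nat -> R) r : 0 <= r ->
  (forall c i, poly_act (weightsC w) l c i = (D i)%:C * c i) ->
  coord_norm_le w l r <-> forall i, `|D i| <= r.
Proof.
move=> r0 DE; split=> [H i|H N c cN N'].
  pose c n : R[i] := (n == i)%:R.
  have cN : supp_below i.+1 c.
    by move=> n; rewrite /c; case: eqP => // ->; rewrite ltnn.
  have := H _ _ cN i.+1; rewrite /sqnorm !big_ord_recr /= !big1.
  - rewrite !add0r DE /c eqxx mulr1 normr1 expr1n mulr1 normcR -rmorphXn lecR.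
    by rewrite ler_pXn2r ?nnegrE.
  - by move=> j _; rewrite /c ltn_eqF// normr0 expr0n.
  - by move=> j _; rewrite DE /c ltn_eqF// mulr0 normr0 expr0n.
have r20 : 0 <= (r ^+ 2)%:C by rewrite lecR sqr_ge0.
have le1 : sqnorm N' (poly_act (weightsC w) l c) <= (r ^+ 2)%:C * sqnorm N' c.
  rewrite /sqnorm mulr_sumr ler_sum// => i _; rewrite DE normrM exprMn.
  rewrite ler_wpM2r ?exprn_ge0// normcR -rmorphXn lecR.
  by rewrite ler_pXn2r ?nnegrE.
apply: le_trans le1 _; rewrite ler_wpM2l//.
apply: le_trans (_ : sqnorm (N + N') c <= _).
  by rewrite sqnorm_widen// leq_addl.
rewrite /sqnorm big_split_ord /= [X in _ + X]big1 ?addr0// => i _.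
by rewrite cN ?leq_addr// normr0 expr0n.
Qed.

Lemma defectC w (g : nat -> R) n i :
  defect (weightsC w) (weightsC g) n i = (defect w g n i)%:C.
Proof.
rewrite /defect rmorphD rmorphXn /=; congr (_ ^+ _ + _); first by case: i.
rewrite rmorph_sum; apply: eq_bigr => k _.
by rewrite rmorphM !rmorphXn rmorph_prod rmorphB rmorphXn.
Qed.

Lemma defect_ge0 w (g : nat -> R) n i : 0 <= defect w g n i.
Proof.
rewrite /defect addr_ge0 ?sqr_ge0// sumr_ge0// => k _.
by rewrite mulr_ge0 ?sqr_ge0.
Qed.

Lemma defect_bound w (g : nat -> R) n M : (forall i, `|w i| <= M) ->
  exists B, forall i, defect w g n i <= B.
Proof.
move=> wM; have M0 : 0 <= M by apply: le_trans (wM 0%N).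
have sq (t u : R) : `|t| <= u -> t ^+ 2 <= u ^+ 2.
  move=> tu; rewrite -real_normK ?num_real//.
  by rewrite ler_pXn2r ?nnegrE// (le_trans _ tu).
exists (M ^+ 2 + \sum_(k < n) (M ^+ k) ^+ 2 * (M ^+ 2 + `|g k|) ^+ 2) => i.
rewrite lerD//; first by case: i => [|i]; rewrite ?expr0n ?sqr_ge0//= sq.
apply: ler_sum => k _; apply: ler_pM; rewrite ?sqr_ge0//; apply: sq.
  have -> : M ^+ k = \prod_(m < k) M by rewrite prodr_const card_ord.
  rewrite normr_prod ler_prod// => m _.
  by rewrite wM normr_ge0.
rewrite (le_trans (ler_normB _ _))// lerD// normrX ler_pXn2r ?nnegrE//.
Qed.

(** If all defects of [x] were at least [eps], then with [B] an upper bound of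
these defects the diagonal polynomial with constant [B + eps] would have norm at
most [B] for [x], but it has the entry [B + eps] for [a]. *)
Lemma coord_dominates_defect a x M (g : nat -> R) n s : (forall i, `|x i| <= M) ->
  coord_dominates a x -> defect a g n s = 0 ->
  forall eps, 0 < eps -> exists j, defect x g n j < eps.
Proof.
move=> xM ax as0 eps eps0; apply: contrapT => nj.
have xe j : eps <= defect x g n j.
  by rewrite leNgt; apply/negP => ?; apply: nj; exists j.
have [B xB] := defect_bound g n xM.
have B0 : 0 <= B by rewrite (le_trans (defect_ge0 x g n 0%N)).
pose l := defect_poly (B + eps)%:C (weightsC g) n.
have lE w c i : poly_act (weightsC w) l c i = (B + eps - defect w g n i)%:C * c i.
  by rewrite poly_act_defect defectC rmorphB.
have /(ax _ _ B0)/(coord_norm_le_diag B0 (lE a))/(_ s) : coord_norm_le x l B.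
  apply/(coord_norm_le_diag B0 (lE x)) => i; have := xe i; have := xB i => h1 h2.
  by rewrite ger0_norm; lra.
by rewrite as0 subr0 ger0_norm; lra.
Qed.

(** Keeps the weights in front of the [k]-th term of the defect away from 0, so
that a small term forces the next weight to be close to its target. *)
Lemma prod_lower_bound (b : nat -> R) n : (forall k, (k < n)%N -> 0 < b k) ->
  exists2 p, 0 < p & exists2 eta, 0 < eta & forall y : nat -> R,
    (forall i, (i < n)%N -> `|y i - b i| < eta) -> p <= \prod_(m < n) y m.
Proof.
elim: n => [|n IH] b0.
  by exists 1 => //; exists 1 => // y _; rewrite big_ord0.
case: IH => [k kn|p p0 [eta eta0 H]]; first by apply: b0; rewrite ltnW.
have bn := b0 n (leqnn _).
exists (p * (b n / 2)); first by rewrite mulr_gt0// divr_gt0.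
exists (Order.min eta (b n / 2)); first by rewrite lt_min eta0 divr_gt0.
move=> y yb; rewrite big_ord_recr /=.
have h1 : p <= \prod_(m < n) y m.
  by apply: H => i iN; have := yb i (ltnW iN); rewrite lt_min => /andP[].
have h2 : b n / 2 <= y n.
  have := yb n (leqnn _); rewrite lt_min => /andP[_].
  by rewrite ltr_norml => /andP[]; lra.
by rewrite ler_pM// ltW// divr_gt0.
Qed.

(** Induction along the window: once the first [n] weights are close to nonzero
targets, their product is bounded below and the term of index [n] controls the
next weight. For nonnegative numbers [(y - b)^2 <= |y^2 - b^2|], whence the power
[eps ^+ 4]. *)
Lemma defect_small (b : nat -> R) n : (forall k, 0 <= b k) ->
  (forall k, (k.+1 < n)%N -> b k != 0) ->
  forall eps, 0 < eps -> exists2 del, 0 < del &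
  forall x j, (forall i, 0 <= x i) ->
    defect x (fun k => b k ^+ 2) n j < del ->
    (if j is i.+1 then x i else 0) < eps /\
    forall i, (i < n)%N -> `|x (j + i)%N - b i| < eps.
Proof.
move=> b0; elim: n => [|n IH] bn eps eps0.
  exists (eps ^+ 2); first by rewrite exprn_gt0.
  move=> x j x0; rewrite /defect big_ord0 addr0 => h; split=> //.
  by move: h; rewrite ltr_pXn2r ?nnegrE// ?(ltW eps0)//; case: j.
have [k kn|p p0 [eta eta0 Hp]] := @prod_lower_bound b n.
  by rewrite lt0r bn ?b0.
have [k kn||d1 d10 H1] := IH _ (Order.min eps eta).
- by apply: bn; apply: ltnW.
- by rewrite lt_min eps0.
exists (Order.min d1 (p ^+ 2 * eps ^+ 4)).
  by rewrite lt_min d10 mulr_gt0 ?exprn_gt0.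
move=> x j x0; rewrite lt_min => /andP[hd1 hd2].
have defE : defect x (fun k => b k ^+ 2) n.+1 j =
    defect x (fun k => b k ^+ 2) n j +
    (\prod_(m < n) x (j + m)%N) ^+ 2 * (x (j + n)%N ^+ 2 - b n ^+ 2) ^+ 2.
  by rewrite /defect big_ord_recr addrA.
have t0 : 0 <= (\prod_(m < n) x (j + m)%N) ^+ 2 *
    (x (j + n)%N ^+ 2 - b n ^+ 2) ^+ 2.
  by rewrite mulr_ge0 ?sqr_ge0.
have [|h1 h2] := H1 x j x0; first by rewrite (le_lt_trans _ hd1)// defE lerDl.
split=> [|i]; first by move: h1; rewrite lt_min => /andP[].
rewrite ltnS leq_eqVlt => /predU1P[->|/h2]; last by rewrite lt_min => /andP[].
have pp : p <= \prod_(m < n) x (j + m)%N.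
  apply: (Hp (fun m => x (j + m)%N)) => m /h2; by rewrite lt_min => /andP[].
rewrite ltNge; apply/negP => he.
suff : p ^+ 2 * eps ^+ 4 <=
    (\prod_(m < n) x (j + m)%N) ^+ 2 * (x (j + n)%N ^+ 2 - b n ^+ 2) ^+ 2.
  have := defect_ge0 x (fun k => b k ^+ 2) n j; lra.
apply: ler_pM; rewrite ?exprn_ge0 ?(ltW eps0) ?(ltW p0)//.
  by rewrite ler_pXn2r ?nnegrE ?(ltW p0)// (le_trans _ pp) ?(ltW p0).
rewrite -[4%N]/(2 * 2)%N exprM -[leRHS]real_normK ?num_real//.
rewrite ler_pXn2r ?nnegrE ?sqr_ge0// subr_sqr normrM expr2 ler_pM ?(ltW eps0)//.
rewrite (le_trans he)// ger0_norm ?addr_ge0// ler_norml.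
have := x0 (j + n)%N; have := b0 n => ? ?; lra.
Qed.

(** If the approximating windows cannot be found at positive indices, then all of
them sit at index 0, where closeness for every [eps] is equality. *)
Lemma coord_dominates_block_matches a x M :
  (forall i, 0 <= a i) -> (forall i, 0 <= x i) -> (forall i, `|x i| <= M) ->
  coord_dominates a x -> block_matches a x.
Proof.
move=> a0 x0 xM ax s n [sa an].
pose b k := a (s + k)%N.
have d0 : defect a (fun k => b k ^+ 2) n s = 0.
  rewrite /defect big1 ?addr0; last by move=> k _; rewrite subrr expr0n mulr0.
  by case: s sa {an b} => [|s [//|/= ->]]; rewrite expr0n.
have near0 eps : 0 < eps -> exists j, (if j is i.+1 then x i else 0) < eps /\
    forall i, (i < n)%N -> `|x (j + i)%N - b i| < eps.
  move=> eps0; have [del del0 Hd] := @defect_small b n (fun k => a0 _) an _ eps0.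
  have [j xj] := coord_dominates_defect xM ax d0 del0.
  by exists j; apply: Hd.
have [|W] := pselect (window_limit x n b); first by left.
right=> i iN; apply/eqP; rewrite -subr_eq0 -normr_le0.
apply/ler_addgt0Pr => eps eps0; rewrite add0r.
move/existsNP: W => W'; have [eps1 /not_implyP[eps10 {}W]] := W'.
have [|[|j] [h1 h2]] := near0 (Order.min eps eps1).
- by rewrite lt_min eps0.
- by have := h2 _ iN; rewrite lt_min => /andP[/ltW].
case: W; exists j; move: h1; rewrite lt_min ger0_norm// => /andP[_ ->].
split=> // k /h2.
by rewrite lt_min => /andP[].
Qed.

End domination.

(** * The scalar product *)

Section dot_theory.
Variables (R : realType) (H : hilbertType R).
Implicit Types (x y z : H) (k : R[i]).

Lemma dotDr x y z : dot x (y + z) = dot x y + dot x z.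
Proof. by rewrite (dotC (y + z)) dotDl rmorphD /= -!dotC. Qed.

Lemma dotZr k x y : dot x (k *: y) = k^* * dot x y.
Proof. by rewrite (dotC (k *: y)) dotZl rmorphM /= -dotC. Qed.

Lemma dot0l y : dot (0 : H) y = 0.
Proof. by rewrite -(scale0r 0) dotZl mul0r. Qed.

Lemma dot0r y : dot y (0 : H) = 0.
Proof. by rewrite (dotC 0) dot0l rmorph0. Qed.

Lemma dotNl x y : dot (- x) y = - dot x y.
Proof. by rewrite -scaleN1r dotZl mulN1r. Qed.

Lemma dotNr x y : dot x (- y) = - dot x y.
Proof. by rewrite -scaleN1r dotZr rmorphN rmorph1 mulN1r. Qed.

Lemma dotBl x y z : dot (x - y) z = dot x z - dot y z.
Proof. by rewrite dotDl dotNl. Qed.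

Lemma dotBr x y z : dot x (y - z) = dot x y - dot x z.
Proof. by rewrite dotDr dotNr. Qed.

Lemma dot_suml (I : Type) (r : seq I) (F : I -> H) y :
  dot (\sum_(i <- r) F i) y = \sum_(i <- r) dot (F i) y.
Proof. by elim/big_ind2: _ => [|? ? ? ? <- <-|//]; rewrite ?dot0l// dotDl. Qed.

Lemma dot_sumr (I : Type) (r : seq I) (F : I -> H) y :
  dot y (\sum_(i <- r) F i) = \sum_(i <- r) dot y (F i).
Proof. by elim/big_ind2: _ => [|? ? ? ? <- <-|//]; rewrite ?dot0r// dotDr. Qed.

Lemma cauchy_schwarz x y : `|dot x y| <= `|x| * `|y|.
Proof.
have [->|y0] := eqVneq y 0; first by rewrite dot0r !normr0 mulr0.
have ny0 : `|y| != 0 by rewrite normr_eq0.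
have n2 : 0 < `|y| ^+ 2 by rewrite exprn_gt0// normr_gt0.
pose t := dot x y / `|y| ^+ 2.
have : 0 <= `|x - t *: y| ^+ 2 by rewrite exprn_ge0.
have tE : t * `|y| ^+ 2 = dot x y by rewrite /t divfK// gt_eqF.
rewrite -dotxx dotBl !dotBr !dotZl !dotZr !dotxx [t * (_ * _)]mulrCA tE.
rewrite opprB addrA subrK subr_ge0 => h.
have : `|dot x y| ^+ 2 <= (`|x| * `|y|) ^+ 2.
  rewrite exprMn -ler_pdivrMr// normCK; apply: le_trans h.
  by rewrite /t mulrAC (dotC x y).
by rewrite ler_pXn2r ?nnegrE ?mulr_ge0.
Qed.

End dot_theory.

(** * Orthonormal bases *)

Section basis.
Variables (R : realType) (H : hilbertType R) (e : nat -> H).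
Hypothesis he : orthonormal_basis e.

Definition span_vec N (c : nat -> R[i]) : H := \sum_(i < N) c i *: e i.

Lemma dot_span_vec_basis N c j :
  dot (span_vec N c) (e j) = if (j < N)%N then c j else 0.
Proof.
rewrite /span_vec dot_suml; case: ltnP => jN.
  rewrite (bigD1 (Ordinal jN))//= big1.
    by rewrite addr0 dotZl he.1 eqxx mulr1.
  move=> i /negP ij; rewrite dotZl he.1 (_ : (i == j :> nat) = false) ?mulr0//.
  exact/negP.
rewrite big1// => i _; rewrite dotZl he.1 ltn_eqF ?mulr0//.
by rewrite (leq_trans (ltn_ord i)).
Qed.

Lemma norm_span_vec N c : `|span_vec N c| ^+ 2 = sqnorm N c.
Proof.
rewrite -dotxx {2}/span_vec dot_sumr; apply: eq_bigr => i _.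
by rewrite dotZr dot_span_vec_basis ltn_ord mulrC normCK.
Qed.

Lemma span_vec_widen N N' c : supp_below N c -> (N <= N')%N ->
  span_vec N' c = span_vec N c.
Proof.
move=> cN /subnKC <-; rewrite /span_vec big_split_ord /=.
rewrite [X in _ + X]big1 ?addr0// => i _.
by rewrite cN ?leq_addr// scale0r.
Qed.

(** The truncation of [c] at [N] does not change the vector, and makes its
coordinates available to the calculus of finitely supported sequences. *)
Lemma span_vec_dense x (eps : R[i]) : 0 < eps ->
  exists N c, supp_below N c /\ `|x - span_vec N c| < eps.
Proof.
move=> eps0; have : closure (linear_span e) x by rewrite he.2.
move=> /(_ _ (nbhsx_ballx x eps eps0)) [y [[N [c yE]] xy]].
exists N, (fun n => if (n < N)%N then c n else 0); split.
  by move=> n Nn; rewrite ltnNge Nn.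
rewrite [span_vec _ _](_ : _ = y); first by rewrite -ball_normE in xy.
by rewrite yE; apply: eq_bigr => i _; rewrite ltn_ord.
Qed.

(** A bounded linear functional that vanishes on the basis vanishes on a dense set,
hence everywhere. *)
Lemma linear_bounded_eq0 (g : H -> R[i]) (M : R[i]) :
  (forall x y, g (x + y) = g x + g y) -> (forall k x, g (k *: x) = k * g x) ->
  (forall x, `|g x| <= M * `|x|) -> (forall i, g (e i) = 0) -> forall x, g x = 0.
Proof.
move=> gD gZ gM ge x.
have M0 : 0 <= M.
  rewrite -[M]mulr1 -(_ : `|e 0%N| = 1) ?(le_trans _ (gM _))//.
  by apply/eqP; rewrite -(@pexpr_eq1 _ _ 2)// -dotxx he.1.
have g0 : g 0 = 0 by rewrite -(scale0r 0) gZ mul0r.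
have gN y : g (- y) = - g y by rewrite -scaleN1r gZ mulN1r.
have gemb N c : g (span_vec N c) = 0.
  rewrite /span_vec; elim/big_ind: _ => //= [y z yE zE|i _].
    by rewrite gD yE zE addr0.
  by rewrite gZ ge mulr0.
apply/eqP; rewrite -normr_le0; apply/ler_addgt0Pr => eps eps0; rewrite add0r.
have M1 : 0 < M + 1 by rewrite ltr_wpDl.
have [N [c [_ h]]] := span_vec_dense x (divr_gt0 eps0 M1).
rewrite -[x](subrK (span_vec N c)) gD gemb addr0 (le_trans (gM _))//.
apply: le_trans (_ : (M + 1) * (eps / (M + 1)) <= _); last first.
  by rewrite mulrC divfK// gt_eqF.
by apply: ler_pM => //; [rewrite lerDl|exact: ltW].
Qed.

Lemma basis_dot_eq0 z : (forall i, dot (e i) z = 0) -> z = 0.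
Proof.
move=> zi; have /(_ z) : forall x, dot x z = 0.
  apply: (@linear_bounded_eq0 (fun x => dot x z) `|z|) => //.
  - by move=> x y; rewrite dotDl.
  - by move=> k x; rewrite dotZl.
  - by move=> x; rewrite mulrC cauchy_schwarz.
by rewrite dotxx => /eqP; rewrite expf_eq0 normr_eq0 => /andP[_ /eqP].
Qed.

End basis.

Lemma dotZr_real (R : realType) (H : hilbertType R) (t : R) (x y : H) :
  dot x (t%:C *: y) = t%:C * dot x y.
Proof. by rewrite dotZr; congr (_ * _); exact: conjc_real. Qed.

(** * Existence of the adjoint of a shift *)

Section shift_operator.
Variables (R : realType) (H : hilbertType R) (e : nat -> H).
Hypothesis he : orthonormal_basis e.
Variables (w : nat -> R) (T : H -> H).
Hypothesis hT : weighted_shift e w T.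

Lemma norm_basis i : `|e i| = 1.
Proof. by apply/eqP; rewrite -(@pexpr_eq1 _ _ 2)// -dotxx he.1 eqxx. Qed.

Lemma shift_bound : exists2 M : R, 0 <= M & forall x, `|T x| <= M%:C * `|x|.
Proof.
have [[_ [M HM]] _] := hT; exists `|M|; first exact: normr_ge0.
by move=> x; rewrite (le_trans (HM x))// ler_wpM2r// lecR ler_norm.
Qed.

Lemma weights_bound : exists M : R, forall i, `|w i| <= M.
Proof.
have [M _ HM] := shift_bound; exists M => i; have := HM (e i).
by rewrite hT.2 normrZ !norm_basis !mulr1 normcR lecR.
Qed.

Lemma shiftD x y : T (x + y) = T x + T y.
Proof. by have [[L _] _] := hT; have := L 1 x y; rewrite !scale1r. Qed.

Lemma shiftZ k x : T (k *: x) = k *: T x.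
Proof.
have [[L _] _] := hT; have T0 : T 0 = 0.
  have := shiftD 0 0; rewrite addr0 => /(congr1 (fun z => z - T 0)).
  by rewrite addrK subrr.
by have := L k x 0; rewrite !addr0 T0 addr0.
Qed.

(** [z] is the value at [y] of an adjoint of [T]; the vectors [y] that have such a
value form a closed subspace containing the basis. *)
Definition adjoint_at y z := forall x, dot (T x) y = dot x z.

Lemma adjoint_at_inj y z z' : adjoint_at y z -> adjoint_at y z' -> z = z'.
Proof.
move=> h h'; apply/eqP; rewrite -subr_eq0; apply/eqP.
apply: (basis_dot_eq0 he) => i.
by rewrite dotBr -h -h' subrr.
Qed.

Lemma adjoint_atD y y' z z' : adjoint_at y z -> adjoint_at y' z' ->
  adjoint_at (y + y') (z + z').
Proof. by move=> h h' x; rewrite !dotDr h h'. Qed.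

Lemma adjoint_atZ k y z : adjoint_at y z -> adjoint_at (k *: y) (k *: z).
Proof. by move=> h x; rewrite !dotZr h. Qed.

(** From [|z|^2 = <T z, y>] and the Cauchy-Schwarz inequality. *)
Lemma adjoint_at_norm (M : R) y z : (forall x, `|T x| <= M%:C * `|x|) ->
  adjoint_at y z -> `|z| <= M%:C * `|y|.
Proof.
move=> HM h; have [->|z0] := eqVneq z 0.
  rewrite normr0 mulr_ge0// lecR.
  by have := le_trans (normr_ge0 _) (HM (e 0%N)); rewrite norm_basis mulr1 lecR.
have nz : 0 < `|z| by rewrite normr_gt0.
rewrite -(ler_pM2l nz) -expr2 -dotxx -h -[dot _ _]ger0_norm; last first.
  by rewrite h dotxx exprn_ge0.
rewrite (le_trans (cauchy_schwarz _ _))// mulrA ler_wpM2r//.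
by rewrite mulrC HM.
Qed.

Lemma adjoint_at_basis j :
  adjoint_at (e j) (if j is i.+1 then (w i)%:C *: e i else 0).
Proof.
set z := (X in adjoint_at _ X); have [M M0 HM] := shift_bound.
suff h : forall x, dot (T x) (e j) - dot x z = 0.
  by move=> x; apply/eqP; rewrite -subr_eq0 h.
apply: (@linear_bounded_eq0 _ _ _ he _ (M%:C + `|z|)).
- by move=> x y; rewrite shiftD !dotDl opprD addrACA.
- by move=> k x; rewrite shiftZ !dotZl mulrBr.
- move=> x; rewrite (le_trans (ler_normB _ _))// mulrDl lerD//.
    by rewrite (le_trans (cauchy_schwarz _ _))// norm_basis mulr1.
  by rewrite (le_trans (cauchy_schwarz _ _))// mulrC.
move=> i; rewrite hT.2 dotZl he.1 /z; case: j {z} => [|j].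
  by rewrite mulr0 dot0r subrr.
rewrite dotZr_real he.1 eqSS; have [->|ij] := eqVneq i j.
  by rewrite subrr.
by rewrite !mulr0 subrr.
Qed.

Lemma adjoint_at_span_vec N c : exists z, adjoint_at (span_vec e N c) z.
Proof.
elim: N => [|N [z hz]].
  by exists 0 => x; rewrite /span_vec big_ord0 !dot0r.
exists (z + c N *: (if N is i.+1 then (w i)%:C *: e i else 0)).
rewrite /span_vec big_ord_recr /=; apply: adjoint_atD => //.
by apply: adjoint_atZ; apply: adjoint_at_basis.
Qed.

(** Approximate [y] by finitely supported vectors. By [adjoint_at_norm] their
adjoint values form a Cauchy sequence, and its limit is the value at [y]. *)
Lemma adjoint_ex y : exists z, adjoint_at y z.
Proof.
have [M M0 HM] := shift_bound.
pose eps n : R[i] := (n.+1%:R^-1)%:C.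
have eps0 n : 0 < eps n by rewrite ltcR invr_gt0 ltr0n.
have /choice[u uP] : forall n, exists p : H * H,
    `|y - p.1| < eps n /\ adjoint_at p.1 p.2.
  move=> n; have [N [c [_ h]]] := span_vec_dense he y (eps0 n).
  by have [z hz] := adjoint_at_span_vec N c; exists (span_vec e N c, z).
have small (d : R[i]) : 0 < d -> \forall n \near \oo, eps n < d.
  move=> d0; have dE : (complex.Re d)%:C = d by rewrite RRe_real// gtr0_real.
  have d0' : 0 < complex.Re d by rewrite -ltcR dE.
  apply: filterS (near_infty_natSinv_lt (PosNum d0')) => n /=.
  by rewrite -{2}dE ltcR.
have M1 : 0 < M%:C + 1 :> R[i] by rewrite ltr_wpDl// lecR.
have uD n m : `|(u n).2 - (u m).2| <= M%:C * (eps n + eps m).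
  have [h1 h2] := uP n; have [h3 h4] := uP m.
  have h5 : adjoint_at ((u n).1 - (u m).1) ((u n).2 - (u m).2).
    by move=> x; rewrite !dotBr h2 h4.
  rewrite (le_trans (adjoint_at_norm HM h5))// ler_wpM2l ?lecR//.
  have -> : (u n).1 - (u m).1 = (y - (u m).1) - (y - (u n).1).
    by rewrite opprB [_ - _ + _]addrC addrA subrK.
  by rewrite (le_trans (ler_normB _ _))// addrC lerD// ltW.
pose z n := (u n).2.
have zc : cvg (z @ \oo).
  apply: cauchy_cvg; apply: cauchy_exP => d d0.
  have d1 : 0 < d / (M%:C + 1) / 2 by rewrite !divr_gt0.
  have [n0 _ hn] := small _ d1.
  exists (z n0); exists n0 => // m nm; rewrite -ball_normE /=.
  have h1 := hn _ (leqnn n0); have h2 := hn _ nm.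
  apply: le_lt_trans (_ : M%:C * (d / (M%:C + 1)) < _).
    rewrite (le_trans (uD _ _))// ler_wpM2l ?lecR// [leRHS]splitr.
    by rewrite lerD// ltW.
  by rewrite mulrCA gtr_pMr// ltr_pdivrMr// mul1r ltrDl.
exists (lim (z @ \oo)) => x.
apply/eqP; rewrite -subr_eq0 -normr_le0.
apply/ler_addgt0Pr => d d0; rewrite add0r.
pose x1 := `|x| + 1; have x10 : 0 < x1 by rewrite ltr_wpDl.
pose d' := d / x1 / (M%:C + 1); have d'0 : 0 < d' by rewrite !divr_gt0.
have zl : z @ \oo --> lim (z @ \oo) by [].
have [n1 _ h1] := (cvgrPdist_lt _ _).1 zl _ d'0.
have [n2 _ h2] := small _ d'0.
pose n := maxn n1 n2.
have {}h1 : `|lim (z @ \oo) - z n| < d' by apply: h1; exact: leq_maxl.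
have {}h2 : eps n < d' by apply: h2; exact: leq_maxr.
have [h3 h4] := uP n.
have -> : dot (T x) y - dot x (lim (z @ \oo)) =
    dot (T x) (y - (u n).1) - dot x (lim (z @ \oo) - z n).
  by rewrite !dotBr h4 opprB addrA subrK.
apply: le_trans (_ : M%:C * x1 * d' + x1 * d' <= _); last first.
  have -> : M%:C * x1 * d' + x1 * d' = (M%:C + 1) * (d' * x1) by ring.
  rewrite /d' [_ / _ * x1]mulrAC divfK ?gt_eqF// mulrC divfK// gt_eqF//.
rewrite (le_trans (ler_normB _ _))// lerD//.
  rewrite (le_trans (cauchy_schwarz _ _))// ler_pM// ?(ltW (lt_trans h3 h2))//.
  by rewrite (le_trans (HM x))// ler_wpM2l ?lecR// lerDl.
by rewrite (le_trans (cauchy_schwarz _ _))// ler_pM// ?(ltW h1)// lerDl.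
Qed.

End shift_operator.

Section shift_adjoint.
Variables (R : realType) (H : hilbertType R) (e : nat -> H).
Hypothesis he : orthonormal_basis e.
Variables (w : nat -> R) (T : H -> H).
Hypothesis hT : weighted_shift e w T.

Lemma adjointP y : adjoint_at T y (adjoint T y).
Proof. exact: (xgetPex _ (adjoint_ex he hT y)). Qed.

Lemma adjointD x y : adjoint T (x + y) = adjoint T x + adjoint T y.
Proof.
by apply: (adjoint_at_inj he (adjointP _)); apply: adjoint_atD; apply: adjointP.
Qed.

Lemma adjointZ k x : adjoint T (k *: x) = k *: adjoint T x.
Proof.
by apply: (adjoint_at_inj he (adjointP _)); apply: adjoint_atZ; apply: adjointP.
Qed.

Lemma adjoint_bound (M : R) : (forall x, `|T x| <= M%:C * `|x|) ->
  forall y, `|adjoint T y| <= M%:C * `|y|.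
Proof. by move=> HM y; apply: (adjoint_at_norm he HM); apply: adjointP. Qed.

Lemma adjoint_basis j :
  adjoint T (e j) = if j is i.+1 then (w i)%:C *: e i else 0.
Proof. exact: (adjoint_at_inj he (adjointP _) (adjoint_at_basis he hT j)). Qed.

Lemma shift_span_vec N c :
  T (span_vec e N c) = span_vec e N.+1 (shift_act (weightsC w) c).
Proof.
rewrite /span_vec big_ord_recl scale0r add0r.
elim: N => [|N IH].
  by rewrite !big_ord0 -[X in T X](scale0r 0) (shiftZ hT) scale0r.
rewrite !big_ord_recr (shiftD hT) IH (shiftZ hT) hT.2 /=; congr (_ + _).
by rewrite scalerA mulrC.
Qed.

Lemma adjoint_span_vec N c : supp_below N c ->
  adjoint T (span_vec e N c) = span_vec e N (adjoint_act (weightsC w) c).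
Proof.
move=> cN; have -> : adjoint T (span_vec e N c) =
    span_vec e N.-1 (adjoint_act (weightsC w) c).
  have adj0 : adjoint T 0 = 0.
    by rewrite -[X in adjoint T X](scale0r 0) adjointZ scale0r.
  rewrite /span_vec; elim: N {cN} => [|N IH]; first by rewrite !big_ord0.
  rewrite big_ord_recr adjointD IH adjointZ adjoint_basis /=.
  case: N {IH} => [|N] /=; first by rewrite scaler0 addr0 !big_ord0.
  by rewrite big_ord_recr /= scalerA mulrC.
apply/esym/span_vec_widen; last exact: leq_pred.
by move=> n Nn; rewrite /adjoint_act cN ?mulr0//; case: N Nn {cN}.
Qed.

Lemma word_span_vec u c N : supp_below N c ->
  word_eval T (adjoint T) u (span_vec e N c) =
  span_vec e (N + size u) (word_act (weightsC w) u c).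
Proof.
move=> cN; elim: u => [|h u IH]; first by rewrite addn0.
rewrite word_act_cons [size _]/= addnS.
have -> : word_eval T (adjoint T) (h :: u) (span_vec e N c) =
  (if h then adjoint T else T)
    (span_vec e (N + size u) (word_act (weightsC w) u c)).
  by rewrite -IH; case: h.
case: h; last by rewrite shift_span_vec.
have cNu := supp_below_word_act (u := u) (weightsC w) cN.
rewrite adjoint_span_vec// (@span_vec_widen _ _ _ (N + size u))// => n Nn.
by rewrite /adjoint_act cNu ?mulr0// leqW.
Qed.

End shift_adjoint.

(** * Evaluation of polynomials and the operator norm *)

Section linear_evaluation.
Variables (R : realType) (H : hilbertType R).

(** Polynomials as lists of coefficients and words: several terms may carry the
same word, which makes concrete polynomials easy to write down. *)
Definition list_eval (l : seq (R[i] * seq bool)) (A B : H -> H) v : H :=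
  \sum_(t <- l) t.1 *: word_eval A B t.2 v.

Definition bounded_linear (S : H -> H) := [/\ forall x y, S (x + y) = S x + S y,
  forall k x, S (k *: x) = k *: S x &
  exists2 M : R, 0 <= M & forall x, `|S x| <= M%:C * `|x|].

Lemma list_eval_bounded l A B : bounded_linear A -> bounded_linear B ->
  bounded_linear (list_eval l A B).
Proof.
move=> hA hB.
have hw u : bounded_linear (word_eval A B u).
  elim: u => [|h u [D Z [M M0 HM]]].
    by split=> //; exists 1 => // x; rewrite mul1r.
  have : bounded_linear (if h then B else A) by case: h.
  rewrite [word_eval A B (h :: u)](_ : _ =
    (if h then B else A) \o word_eval A B u); last by apply/funext => x; case: h.
  case=> D' Z' [M' M'0 HM']; split=> [x y|k x|] /=; first by rewrite D D'.
    by rewrite Z Z'.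
  exists (M' * M) => [|x]; first exact: mulr_ge0.
  by rewrite (le_trans (HM' _))// rmorphM -mulrA ler_wpM2l ?lecR.
split=> [x y|k x|]; rewrite /list_eval.
- rewrite -big_split; apply: eq_bigr => t _ /=.
  by have [D _ _] := hw t.2; rewrite D scalerDr.
- rewrite scaler_sumr; apply: eq_bigr => t _.
  by have [_ Z _] := hw t.2; rewrite Z !scalerA mulrC.
elim: l => [|t l [M M0 HM]].
  by exists 0 => // x; rewrite big_nil normr0 mul0r.
have [_ _ [M' M'0 HM']] := hw t.2.
have tE : (complex.Re `|t.1|)%:C = `|t.1| by rewrite RRe_real// ger0_real.
exists (complex.Re `|t.1| * M' + M) => [|x].
  by rewrite addr_ge0// mulr_ge0// -ler0c tE.
rewrite big_cons (le_trans (ler_normD _ _))//.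
rewrite rmorphD rmorphM /= tE mulrDl lerD//.
by rewrite normrZ -mulrA ler_wpM2l.
Qed.

(** Every vector of the unit ball is a limit of finitely supported ones, and a
bounded operator is continuous. *)
Lemma opnorm_le (e : nat -> H) (S : H -> H) r : orthonormal_basis e ->
  bounded_linear S -> 0 <= r ->
  opnorm S <= r <-> forall N c, supp_below N c ->
    `|S (span_vec e N c)| <= r%:C * `|span_vec e N c|.
Proof.
move=> he [D Z [M M0 HM]] r0.
have ReE (x : H) : (complex.Re `|x|)%:C = `|x| by rewrite RRe_real// ger0_real.
have S0 : S 0 = 0 by rewrite -[X in S X](scale0r 0) Z scale0r.
rewrite /opnorm; set E := (X in sup X); have E0 : E !=set0.
  by exists (complex.Re `|S 0|); exists 0 => //=; rewrite normr0.
have EM : has_ubound E.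
  exists M => _ [x /= x1 <-]; rewrite -lecR ReE (le_trans (HM x))//.
  by rewrite ler_piMr// lecR.
split=> [le_r N c cN|H1].
  set x := span_vec e N c; have [->|x0] := eqVneq x 0.
    by rewrite S0 normr0 mulr0.
  have nx : 0 < `|x| by rewrite normr_gt0.
  have : complex.Re `|S (`|x|^-1 *: x)| <= r.
    apply: le_trans le_r; apply: ub_le_sup => //; exists (`|x|^-1 *: x) => //=.
    by rewrite normrZ gtr0_norm ?invr_gt0// mulVf ?gt_eqF.
  rewrite -lecR ReE Z normrZ gtr0_norm ?invr_gt0//.
  by rewrite mulrC ler_pdivrMr.
apply: ge_sup => // _ [x /= x1 <-]; rewrite -lecR ReE.
apply/ler_addgt0Pr => d d0.
have K0 : 0 < r%:C + M%:C + 1 :> R[i] by rewrite ltr_wpDl// addr_ge0// lecR.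
have [N [c [cN xc]]] := span_vec_dense he x (divr_gt0 d0 K0).
set y := span_vec e N c in xc; set d' := d / _ in xc.
have d'0 : 0 < d' by rewrite divr_gt0.
have -> : S x = S y + S (x - y) by rewrite -D addrC subrK.
rewrite (le_trans (ler_normD _ _))//.
have h1 : `|S y| <= r%:C * (1 + d').
  rewrite (le_trans (H1 _ _ cN))// ler_wpM2l ?lecR//.
  have -> : span_vec e N c = x - (x - y) by rewrite opprB addrC subrK.
  by rewrite (le_trans (ler_normB _ _))// lerD// ltW.
have h2 : `|S (x - y)| <= M%:C * d'.
  by rewrite (le_trans (HM _))// ler_wpM2l ?lecR// ltW.
apply: (le_trans (lerD h1 h2)).
rewrite mulrDr mulr1 -addrA lerD2l -mulrDl.
apply: le_trans (_ : (r%:C + M%:C + 1) * d' <= _).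
  by rewrite ler_wpM2r// ?(ltW d'0)// lerDl.
by rewrite /d' mulrC divfK// gt_eqF.
Qed.

Lemma opnorm_ge0 (S : H -> H) : bounded_linear S -> 0 <= opnorm S.
Proof.
move=> [D Z [M M0 HM]].
have ReE (x : H) : (complex.Re `|x|)%:C = `|x| by rewrite RRe_real// ger0_real.
have S0 : S 0 = 0 by rewrite -[X in S X](scale0r 0) Z scale0r.
rewrite /opnorm; apply: ub_le_sup; last by exists 0 => /=; rewrite ?S0 normr0.
exists M => _ [x /= x1 <-]; rewrite -lecR ReE (le_trans (HM x))//.
by rewrite ler_piMr// lecR.
Qed.

Definition list_of_poly (p : ncpoly R) : seq (R[i] * seq bool) :=
  [seq (p@_k, fmonom_val k) | k <- msupp p].

Lemma ncpoly_eval_list p (A B : H -> H) :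
  ncpoly_eval p A B = list_eval (list_of_poly p) A B.
Proof. by apply/funext => v; rewrite /list_eval big_map. Qed.

Definition poly_of_list (l : seq (R[i] * seq bool)) : ncpoly R :=
  \sum_(t <- l) << t.1 *g FMonom t.2 >>.

(** Both sides are additive in the list. For the left side this uses that the sum
over the support of a polynomial may be extended to any larger finite set. *)
Lemma ncpoly_eval_poly_of_list l (A B : H -> H) :
  ncpoly_eval (poly_of_list l) A B = list_eval l A B.
Proof.
apply/funext => v; pose F (k : {fmonom bool}) := word_eval A B (fmonom_val k) v.
have evE (p : ncpoly R) (D : {fset {fmonom bool}}) : (msupp p `<=` D)%fset ->
    ncpoly_eval p A B v = \sum_(k <- D) p@_k *: F k.
  move=> pD; rewrite /ncpoly_eval; apply: big_fset_incl => // k _ kp.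
  by rewrite mcoeff_outdom// scale0r.
rewrite /list_eval /poly_of_list; elim: l => [|t l IH].
  by rewrite !big_nil /ncpoly_eval msupp0 big_seq_fset0.
rewrite !big_cons -IH; set p := << _ *g _ >>; set q := \sum_(_ <- _) _.
pose D := (msupp p `|` msupp q `|` [fset FMonom t.2])%fset.
have pD : (msupp p `<=` D)%fset by rewrite /D -fsetUA fsubsetUl.
have qD : (msupp q `<=` D)%fset.
  by rewrite /D [X in (X `|` _)%fset]fsetUC -fsetUA fsubsetUl.
have pqD : (msupp (p + q) `<=` D)%fset.
  by rewrite (fsubset_trans (msuppD_le _ _))// /D fsubsetUl.
rewrite (evE _ _ pqD) (evE _ _ qD).
have -> : \sum_(k <- D) (p + q)@_k *: F k =
    \sum_(k <- D) p@_k *: F k + \sum_(k <- D) q@_k *: F k.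
  by rewrite -big_split; apply: eq_bigr => k _; rewrite mcoeffD scalerDl.
rewrite -(evE _ _ pD); congr (_ + _).
rewrite (evE _ _ (msuppU_le)) big_seq_fset1 mcoeffUU//.
Qed.

End linear_evaluation.

(** * From operators to weight sequences *)

Section lhd.
Variables (R : realType).

Lemma shift_bounded_linear (H : hilbertType R) (e : nat -> H) w T :
  orthonormal_basis e -> weighted_shift e w T -> bounded_linear T.
Proof.
move=> he hT; split; first exact: (shiftD hT).
  exact: (shiftZ hT).
exact: (shift_bound hT).
Qed.

Lemma adjoint_bounded_linear (H : hilbertType R) (e : nat -> H) w T :
  orthonormal_basis e -> weighted_shift e w T -> bounded_linear (adjoint T).
Proof.
move=> he hT; split; [exact: (adjointD he hT)|exact: (adjointZ he hT)|].
have [M M0 HM] := shift_bound hT; exists M => //.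
exact: (adjoint_bound he hT HM).
Qed.

Lemma opnorm_list_eval (H : hilbertType R) (e : nat -> H) w T l r :
  orthonormal_basis e -> weighted_shift e w T -> 0 <= r ->
  opnorm (list_eval l T (adjoint T)) <= r <-> coord_norm_le w l r.
Proof.
move=> he hT r0.
have S := list_eval_bounded l (shift_bounded_linear he hT)
  (adjoint_bounded_linear he hT).
pose d := \max_(t <- l) size t.2.
have dP t : t \in l -> (size t.2 <= d)%N.
  by move=> tl; apply: (@leq_bigmax_seq _ _ xpredT).
have pE N c : supp_below N c ->
    list_eval l T (adjoint T) (span_vec e N c) =
    span_vec e (N + d) (poly_act (weightsC w) l c).
  move=> cN; rewrite /list_eval /span_vec /poly_act.
  under [RHS]eq_bigr do rewrite scaler_suml.
  rewrite exchange_big /=; apply: eq_big_seq => t tl.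
  rewrite -/(span_vec e N c) (word_span_vec he hT _ cN).
  under [RHS]eq_bigr do rewrite -scalerA.
  rewrite -scaler_sumr -/(span_vec e (N + d) (word_act (weightsC w) t.2 c)).
  rewrite (@span_vec_widen _ _ _ (N + size t.2) (N + d))//.
    exact: (supp_below_word_act _ cN).
  by rewrite leq_add2l dP.
have pN N c : supp_below N c -> supp_below (N + d) (poly_act (weightsC w) l c).
  move=> cN n Nn; rewrite /poly_act big_seq big1// => t tl.
  by rewrite (supp_below_word_act _ cN) ?mulr0// (leq_trans _ Nn)// leq_add2l dP.
apply: (iff_trans (opnorm_le he S r0)); rewrite /coord_norm_le; split=> h N c cN.
  move=> N'; have := h N c cN; rewrite pE// => hN.
  rewrite rmorphXn -(norm_span_vec he N c) -exprMn.
  apply: le_trans (_ : sqnorm (N + d + N') (poly_act (weightsC w) l c) <= _).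
    by rewrite sqnorm_widen// leq_addl.
  rewrite -(norm_span_vec he) (span_vec_widen _ (pN _ _ cN)) ?leq_addr//.
  by rewrite ler_pXn2r ?nnegrE ?mulr_ge0 ?lecR.
have := h N c cN (N + d)%N; rewrite -!(norm_span_vec he) -pE// rmorphXn -exprMn.
by rewrite ler_pXn2r ?nnegrE ?mulr_ge0 ?lecR.
Qed.

Lemma lhd_coord_dominates (K H : hilbertType R) (f : nat -> K) (e : nat -> H)
    a x A T :
  orthonormal_basis f -> weighted_shift f a A ->
  orthonormal_basis e -> weighted_shift e x T ->
  lhd_op A T <-> coord_dominates a x.
Proof.
move=> hf hA he hT; split=> [h l r r0|h p].
  move/(opnorm_list_eval l he hT r0) => h1; apply/(opnorm_list_eval l hf hA r0).
  have := h (poly_of_list l); rewrite !ncpoly_eval_poly_of_list => h2.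
  exact: le_trans h2 h1.
rewrite !ncpoly_eval_list; set l := list_of_poly p.
have S := list_eval_bounded l (shift_bounded_linear he hT)
  (adjoint_bounded_linear he hT).
have S0 := opnorm_ge0 S.
apply/(opnorm_list_eval l hf hA S0); apply: h => //.
by apply/(opnorm_list_eval l he hT S0).
Qed.

(** Weights of bounded shifts are bounded, so both implications between
domination and matching of blocks apply. *)
Lemma lhd_block_matches (K H : hilbertType R) (f : nat -> K) (e : nat -> H)
    a x A T :
  orthonormal_basis f -> weighted_shift f a A ->
  orthonormal_basis e -> weighted_shift e x T ->
  (forall i, 0 <= a i) -> (forall i, 0 <= x i) ->
  lhd_op A T <-> block_matches a x.
Proof.
move=> hf hA he hT a0 x0; apply: (iff_trans (lhd_coord_dominates hf hA he hT)).
have [M1 aM] := weights_bound hf hA; have [M2 xM] := weights_bound he hT.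
split; first exact: (coord_dominates_block_matches a0 x0 xM).
apply: (@block_matches_coord_dominates _ _ _ (Order.max M1 M2)) => i;
  rewrite le_max.
  by rewrite aM.
by rewrite xM orbT.
Qed.

End lhd.

(** * Independent events and rectangles *)

Section events.
Context d (Omega : measurableType d) (R : realType) (P : probability Omega R).

(** The second Borel-Cantelli lemma for events of equal probability. The product
rule for complements follows from the one for the events by moving one event
after another to the other side. *)
Lemma independent_events_ae (E : nat -> set Omega) (p : R) :
  (forall m, measurable (E m)) ->
  (forall S : seq nat, uniq S ->
     P (\bigcap_(m in [set` S]) E m) = (p ^+ size S)%:E) ->
  0 < p -> {ae P, forall om, exists m, E m om}.
Proof.
move=> mE hE p0.
have p1 : p <= 1.
  have := hE [:: 0%N] isT; rewrite expr1 => pE.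
  by rewrite -lee_fin -pE probability_le1//; apply: bigcap_measurableType.
(* the events of S occur and the first k events fail *)
pose G (S : seq nat) k :=
  \bigcap_(m in [set` S]) E m `&` \bigcap_(m in `I_k) ~` E m.
have mG S k : measurable (G S k).
  apply: measurableI; apply: bigcap_measurableType => // m _; exact: measurableC.
have PG k S : uniq S -> all (leq k) S ->
    P (G S k) = (p ^+ size S * (1 - p) ^+ k)%:E.
  elim: k S => [|k IH] S uS Sk.
    rewrite expr0 mulr1 -hE//; congr (P _); rewrite /G [X in _ `&` X](_ : _ = setT).
      by rewrite setIT.
    by rewrite -subTset => om _ m.
  have kS : k \notin S by apply/negP => /(allP Sk); rewrite ltnn.
  have -> : G S k.+1 = G S k `\` E k.
    rewrite /G setDE -setIA; congr (_ `&` _); rewrite eqEsubset; split.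
    - move=> om h; split; last by apply: (h k) => /=.
      by move=> m /= mk; apply: h => /=; apply: ltnW.
    - move=> om [h1 h2] m /=; rewrite ltnS leq_eqVlt => /predU1P[->//|]; exact: h1.
  have Sk' : all (leq k) S by apply: sub_all Sk => m; exact: ltnW.
  have -> : P (G S k `\` E k) = (P (G S k) - P (G S k `&` E k))%E.
    by apply: measureD => //; rewrite (le_lt_trans (probability_le1 _ _))// ltry.
  have -> : G S k `&` E k = G (k :: S) k.
    rewrite /G setIAC; congr (_ `&` _); rewrite eqEsubset; split.
    - by move=> om [h1 h2] m /=; rewrite inE => /predU1P[->//|]; apply: h1.
    - move=> om h; split; last by apply: h; rewrite /= mem_head.
      by move=> m /= mS; apply: h; rewrite /= inE mS orbT.
  rewrite !IH//=; [|by rewrite kS|by rewrite leqnn].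
  by rewrite -EFinB; congr (_%:E); rewrite !exprS; ring.
pose N := \bigcap_m ~` E m.
have mN : measurable N by apply: bigcapT_measurable => m; exact: measurableC.
exists N; split=> //; last first.
  by move=> om /= h m _ Em; apply: h; exists m.
apply/eqP; rewrite eq_le measure_ge0 andbT; apply/lee_addgt0Pr => eps eps0.
have q1 : `|1 - p| < 1 by rewrite ger0_norm; lra.
have /cvgrPdist_lt/(_ eps eps0)[k _ /(_ k (leqnn k))] := cvg_expr q1.
rewrite /= sub0r normrN ger0_norm ?exprn_ge0//; last by lra.
move=> h; rewrite add0e; apply: le_trans (_ : P (G [::] k) <= _)%E.
  apply: le_measure; rewrite ?inE// => om h'; split; first by move=> m.
  by move=> m _; exact: h'.
by rewrite PG// expr0 mul1r lee_fin ltW.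
Qed.

Variable X : nat -> {RV P >-> R}.
Hypothesis hX : iid X.

Lemma iid_rectangle (J : seq nat) (B : nat -> set R) : uniq J ->
  (forall j, measurable (B j)) ->
  P (\bigcap_(j in [set` J]) (X j @^-1` B j)) =
  (\prod_(j <- J) P (X 0%N @^-1` B j))%E.
Proof.
move=> uJ mB; rewrite hX.1//; apply: eq_bigr => j _; exact: hX.2.
Qed.

(** The windows at [s], [s + (n+1)], [s + 2 (n+1)], ... are disjoint, hence
independent. *)
Lemma iid_window_ae s n (B : nat -> set R) : (forall i, measurable (B i)) ->
  (forall i, (i < n)%N -> (0 < P (X 0%N @^-1` B i))%E) ->
  {ae P, forall om, exists m, (s <= m)%N /\
     forall i, (i < n)%N -> B i (X (m + i)%N om)}.
Proof.
move=> mB B0.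
pose start m := (s + m * n.+1)%N.
pose E m := [set om | forall i, (i < n)%N -> B i (X (start m + i)%N om)].
have /choice[q qP] i : exists q, P (X 0%N @^-1` B i) = q%:E.
  exists (fine (P (X 0%N @^-1` B i))); rewrite fineK//.
  by apply: fin_num_measure; exact: measurable_funPTI.
pose p := \prod_(i < n) q i.
have : {ae P, forall om, exists m, E m om}; last first.
  apply: filterS => om [m Em]; exists (start m); split=> //; exact: leq_addr.
apply: (@independent_events_ae E p).
- move=> m.
  rewrite [E m](_ : _ = \bigcap_(i in `I_n) (X (start m + i)%N @^-1` B i)).
    by apply: bigcap_measurableType => i _; exact: measurable_funPTI.
  by rewrite eqEsubset; split=> om h i; apply: h.
- move=> S uS.
  pose J := [seq (start m + i)%N | m <- S, i <- iota 0 n].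
  pose B' j := B ((j - s) %% n.+1)%N.
  have B'E m i : (i < n)%N -> B' (start m + i)%N = B i.
    move=> iN; rewrite /B' /start -addnA addKn modnMDl modn_small//; exact: ltnW.
  have startI m m' i i' : (i < n)%N -> (i' < n)%N ->
      (start m + i = start m' + i')%N -> m = m' /\ i = i'.
    move=> iN iN'; rewrite /start -!addnA => /addnI h; split.
      have := congr1 (divn^~ n.+1) h.
      by rewrite /= !divnMDl// !divn_small ?addn0//; apply: ltnW.
    have := congr1 (modn^~ n.+1) h.
    by rewrite /= !modnMDl !modn_small//; apply: ltnW.
  have uJ : uniq J.
    apply: allpairs_uniq => //; first exact: iota_uniq.
    move=> [m i] [m' i'] /allpairsP[[m1 i1] /= [_ i1n [-> ->]]].
    move=> /allpairsP[[m2 i2] /= [_ i2n [-> ->]]] h.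
    move: i1n i2n; rewrite !mem_iota !add0n /= => i1n i2n.
    by have [-> ->] := startI _ _ _ _ i1n i2n h.
  have -> : \bigcap_(m in [set` S]) E m =
      \bigcap_(j in [set` J]) (X j @^-1` B' j).
    rewrite eqEsubset; split=> om h.
      move=> j /allpairsP[[m i] /= [mS]]; rewrite mem_iota add0n /= => iN ->.
      by rewrite B'E//; apply: h.
    move=> m /= mS i iN; rewrite -(B'E m)//.
    apply: (h (start m + i)%N) => /=; apply/allpairsP; exists (m, i); split=> //.
    by rewrite mem_iota add0n.
  rewrite iid_rectangle//; last by move=> j; exact: mB.
  rewrite /J big_allpairs_dep.
  rewrite (eq_bigr (fun _ => p%:E)).
    by elim: (S) => [|k S' IH]; rewrite ?big_nil// big_cons IH /= exprS EFinM.
  move=> m _; rewrite /p -prodEFin.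
  rewrite -[X in iota 0 X]subn0 -/(index_iota 0 n) big_mkord.
  by apply: eq_bigr => i _; rewrite B'E.
apply: prodr_gt0 => i _; rewrite -lte_fin -qP; exact: B0.
Qed.

Lemma iid_rectangle_gt0 n (B : nat -> set R) : (forall i, measurable (B i)) ->
  (forall i, (i < n)%N -> (0 < P (X 0%N @^-1` B i))%E) ->
  (0 < P [set om | forall i, (i < n)%N -> B i (X i om)])%E.
Proof.
move=> mB B0.
have -> : [set om | forall i, (i < n)%N -> B i (X i om)] =
    \bigcap_(j in [set` iota 0 n]) (X j @^-1` B j).
  rewrite eqEsubset; split=> om h i /=.
    by rewrite mem_iota add0n /=; apply: h.
  by move=> iN; apply: (h i) => /=; rewrite mem_iota.
rewrite iid_rectangle// ?iota_uniq// big_seq; elim/big_ind: _ => // [x y|i].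
  exact: mule_gt0.
by rewrite mem_iota add0n => /= /B0.
Qed.

End events.

(** * The essential range and measurability *)

Section essential_range.
Context d (Omega : measurableType d) (R : realType) (P : probability Omega R).
Variable X : nat -> {RV P >-> R}.
Hypothesis hX : iid X.

Lemma closed_essran : closed (essran (X 0%N)).
Proof.
move=> x xcl U oU Ux.
have [y [yG yU]] := xcl _ (open_nbhs_nbhs (conj oU Ux)).
exact: yG.
Qed.

Lemma essran_ball_gt0 v (eps : R) : essran (X 0%N) v -> 0 < eps ->
  (0 < P (X 0%N @^-1` ball v eps))%E.
Proof.
move=> vG eps0; apply: (vG (ball v eps)); first exact: ball_open.
exact: ballxx.
Qed.

(** The complement of the essential range is a union of null intervals with
rational endpoints, hence null. *)
Lemma ae_essran : {ae P, forall om, forall n, essran (X 0%N) (X n om)}.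
Proof.
pose I (pq : rat * rat) : set R := `]ratr pq.1, ratr pq.2[%classic.
have null n k : {ae P, forall om, forall pq, choice.unpickle k = Some pq ->
    P (X 0%N @^-1` I pq) = 0%E -> ~ I pq (X n om)}.
  case: (choice.unpickle k) => [pq|]; last by apply: aeW.
  have [pq0|pq0] := pselect (P (X 0%N @^-1` I pq) = 0%E); last first.
    by apply: aeW => om _ [<-].
  exists (X n @^-1` I pq); split.
  - by apply: measurable_funPTI; exact: measurable_itv.
  - by rewrite -pq0; apply: (hX.2 n (I pq)); exact: measurable_itv.
  - by move=> om /= /existsNP[pq'] /not_implyP[[<-]] /not_implyP[_ /contrapT].
have : {ae P, forall om, forall n k pq, choice.unpickle k = Some pq ->
    P (X 0%N @^-1` I pq) = 0%E -> ~ I pq (X n om)}.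
  by apply: ae_foralln => n; apply: ae_foralln => k; exact: null.
apply: filterS => om h n U oU Ux.
rewrite lt0e measure_ge0 andbT; apply/eqP => U0.
have /nbhs_ballP[e /= e0 eU] := open_nbhs_nbhs (conj oU Ux).
have [p] := @rat_in_itvoo _ (X n om - e) (X n om) (ltac:(lra)).
have [q] := @rat_in_itvoo _ (X n om) (X n om + e) (ltac:(lra)).
rewrite !in_itv /= => /andP[q1 q2] /andP[p1 p2].
apply: (h n (choice.pickle (p, q)) (p, q) (choice.pickleK _)); last first.
  by rewrite /I /= in_itv /= p2.
apply/eqP; rewrite eq_le measure_ge0 andbT -U0.
apply: le_measure; rewrite ?inE.
- by apply: measurable_funPTI; exact: measurable_itv.
- exact: (measurable_funPTI _ (measurable_realfun.open_measurable oU)).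
move=> om'; rewrite /I /= in_itv /= => /andP[h1 h2]; apply: eU.
by rewrite -ball_normE /= ltr_norml; apply/andP; split; lra.
Qed.

(** Apart from [forall eps], replaced by [1 / (k + 1)], all quantifiers in the
description by windows range over natural numbers. *)
Lemma measurable_block_matches (a : nat -> R) :
  measurable [set om | block_matches a (fun i => X i om)].
Proof.
have mB j v (eps : R) : measurable [set om | `|X j om - v| < eps].
  rewrite (_ : mkset _ = X j @^-1` [set x | `|x - v| < eps]) //.
  apply: measurable_funPTI; apply: measurable_realfun.open_measurable.
  rewrite (_ : mkset _ = ball v eps); first exact: ball_open.
  by rewrite -ball_normE /=; apply/funext => x /=; rewrite distrC.
have mW m n v (eps : R) : measurable [set om | forall i, (i < n)%N ->
    `|X (m + i)%N om - v i| < eps].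
  rewrite (_ : mkset _ =
    \bigcap_(i in `I_n) [set om | `|X (m + i)%N om - v i| < eps]).
    exact: bigcap_measurableType.
  by rewrite eqEsubset; split=> om h i; apply: h.
rewrite (_ : mkset _ = \bigcap_s \bigcap_n [set om | block_prefix a s n ->
    block_match a s n (fun i => X i om)]); last first.
  by rewrite eqEsubset; split=> om h s; [move=> _ n _|move=> n]; apply: h.
apply: bigcapT_measurable => s; apply: bigcapT_measurable => n.
have [bp|nbp] := pselect (block_prefix a s n); last first.
  by rewrite (_ : mkset _ = setT)// -subTset => om _ /nbp.
pose v i := a (s + i)%N; pose eps k : R := k.+1%:R^-1.
rewrite (_ : mkset _ = (\bigcap_k \bigcup_j ([set om | `|X j om - 0| < eps k] `&`
      [set om | forall i, (i < n)%N -> `|X (j.+1 + i)%N om - v i| < eps k])) `|`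
    \bigcap_(i in `I_n) (X i @^-1` [set v i])); last first.
  rewrite eqEsubset; split=> om /=.
    move=> /(_ bp)[h|h]; [left=> k _|by right=> i; exact: h].
    have [|j [h1 h2]] := h (eps k); first by rewrite invr_gt0.
    by exists j => //; split=> //=; rewrite subr0.
  move=> [h _|h _]; [left=> e e0|by right=> i; exact: h].
  have [k _ /(_ _ (leqnn k)) ke] := near_infty_natSinv_lt (PosNum e0).
  have [j _ /= [h1 h2]] := h k I; rewrite subr0 in h1.
  by exists j; split=> [|i /h2]; [apply: lt_trans ke|move/lt_trans; apply].
apply: measurableU; last first.
  by apply: bigcap_measurableType => i _; exact: measurable_funPTI.
apply: bigcapT_measurable => k; apply: bigcupT_measurable => j.
exact: measurableI.
Qed.

End essential_range.

(** * Spectra as limits of windows *)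

Section spectra.
Variable R : realType.
Implicit Types (a x v : nat -> R).

Lemma n_spectrumP a n (u : 'rV[R]_n) : (forall i, 0 <= a i) ->
  n_spectrum a n u <-> forall eps, 0 < eps ->
    exists i, forall j : 'I_n, `|a (i + j)%N - u 0 j| < eps.
Proof.
move=> a0; have aE : (fun k => `|a k|) = a by apply/funext => k; rewrite ger0_norm.
rewrite /n_spectrum aE; split=> [h eps eps0|h B].
  have [_ [[i _ <-]] [_ /= H]] := h _ (nbhsx_ballx u eps eps0).
  exists i => j; have := H 0 j; rewrite mxE -ball_normE /= distrC//.
move=> /nbhs_ballP[eps /= eps0 eB]; have [i H] := h _ eps0.
exists (window a i n); split; first by exists i.
apply: eB; split=> // k j; rewrite ord1 mxE -ball_normE /= distrC; exact: H.
Qed.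

Lemma spectrum1_subset a (G : set R) : (forall i, 0 <= a i) -> closed G ->
  n_spectrum a 1 `<=` row_power G 1 <-> forall i, G (a i).
Proof.
move=> a0 cG; split=> [h i|h u /(n_spectrumP u a0) H j].
  have := h (\row_j a i) _ 0; rewrite mxE; apply; apply/n_spectrumP => // eps eps0.
  by exists i => j; rewrite mxE ord1 addn0 subrr normr0.
apply: cG => B /nbhs_ballP[eps /= eps0 eB]; have [i Hi] := H _ eps0.
exists (a i); split; first exact: h.
apply: eB; rewrite -ball_normE /= distrC (_ : j = 0) ?ord1//.
by have := Hi 0; rewrite addn0.
Qed.

Lemma eq_window_limit a n v v' : (forall i, (i < n)%N -> v i = v' i) ->
  window_limit a n v -> window_limit a n v'.
Proof.
move=> vv H eps /H[j [h1 h2]]; exists j; split=> // i iN.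
by rewrite -vv//; exact: h2.
Qed.

Lemma window_limit_closed a n v :
  (forall eps, 0 < eps -> exists2 v', window_limit a n v' &
     forall i, (i < n)%N -> `|v' i - v i| < eps) -> window_limit a n v.
Proof.
move=> H eps eps0; have e2 : 0 < eps / 2 by rewrite divr_gt0.
have [v' /(_ _ e2)[j [h1 h2]] h3] := H _ e2.
exists j; split=> [|i iN]; first by apply: lt_trans h1 _; lra.
have -> : a (j.+1 + i)%N - v i = (a (j.+1 + i)%N - v' i) + (v' i - v i).
  by rewrite addrA subrK.
by rewrite (le_lt_trans (ler_normD _ _))// [ltRHS]splitr ltrD// ?h2// h3.
Qed.

Lemma window_limit_le a m n v : (m <= n)%N ->
  window_limit a n v -> window_limit a m v.
Proof.
move=> mn H eps /H[j [h1 h2]]; exists j; split=> // i im.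
by apply: h2; apply: leq_trans mn.
Qed.

(** A window [(0, v_0, ..., v_(n-1))] in the spectrum: the first entry is the small
weight in front of the window. *)
Lemma spectrum_row_zero a n (u : 'rV[R]_n) v : (forall i, 0 <= a i) ->
  (forall j : 'I_n, u 0 j = v j) ->
  n_spectrum a (1 + n) (row_mx 0 u) <-> window_limit a n v.
Proof.
move=> a0 uv; apply: (iff_trans (n_spectrumP _ a0)).
split=> H eps eps0; have [i h] := H _ eps0.
  exists i; split=> [|j jn].
    by have := h (lshift n 0); rewrite row_mxEl mxE subr0 /= addn0.
  have := h (rshift 1 (Ordinal jn)).
  by rewrite row_mxEr uv /= addnA addn1.
exists i => j; case: (splitP j) => k jk.
  have -> : j = lshift n k by apply: val_inj.
  by rewrite row_mxEl mxE subr0 /= ord1 addn0; exact: h.1.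
have -> : j = rshift 1 k by apply: val_inj.
by rewrite row_mxEr uv /= addnA addn1; exact: h.2.
Qed.

Lemma row_zero_subset a n (G : set R) : (forall i, 0 <= a i) ->
  row_prod row_zero (row_power G n) `<=` n_spectrum a (1 + n) <->
  forall v, (forall i, (i < n)%N -> G (v i)) -> window_limit a n v.
Proof.
move=> a0; split=> [H v vG|H _ [_ -> [u uG <-]]].
  apply/(@spectrum_row_zero _ _ (\row_j v j)) => //; first by move=> j; rewrite mxE.
  apply: H; exists 0 => //; exists (\row_j v j) => // j.
  by rewrite mxE; exact: vG.
pose v i := if insub i is Some j then u 0 j else 0.
have uv (j : 'I_n) : u 0 j = v j by rewrite /v valK.
apply/(spectrum_row_zero a0 uv); apply: H => i iN.
by rewrite /v insubT; exact: uG.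
Qed.

(** The block [v_0, ..., v_(n-1)] followed by its closing zero. *)
Definition pad0 n v i : R := if (i < n)%N then v i else 0.

Lemma framed_subset a n (V : set 'rV[R]_n) : (forall i, 0 <= a i) ->
  row_prod row_zero (row_prod V row_zero) `<=` n_spectrum a (1 + (n + 1)) <->
  forall v, V (\row_j v j) -> window_limit a n.+1 (pad0 n v).
Proof.
move=> a0.
have key (u : 'rV[R]_n) v : (forall j : 'I_n, u 0 j = v j) ->
    n_spectrum a (1 + (n + 1)) (row_mx 0 (row_mx u 0)) <->
    window_limit a n.+1 (pad0 n v).
  move=> uv; rewrite -(addn1 n); apply: spectrum_row_zero => // j; rewrite /pad0.
  case: (splitP j) => k jk.
    have -> : j = lshift 1 k by apply: val_inj.
    by rewrite row_mxEl uv.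
  have -> : j = rshift n k by apply: val_inj.
  by rewrite row_mxEr mxE.
split=> [H v vV|H _ [_ -> [_ [u uV [_ -> <-]] <-]]].
  apply/(key (\row_j v j)); first by move=> j; rewrite mxE.
  apply: H; exists 0 => //; exists (row_mx (\row_j v j) 0) => //.
  by exists (\row_j v j) => //; exists 0.
pose v i := if insub i is Some j then u 0 j else 0.
have uv (j : 'I_n) : u 0 j = v j by rewrite /v valK.
apply/(key _ _ uv); apply: H.
by rewrite (_ : \row_j _ = u)//; apply/rowP => j; rewrite mxE uv.
Qed.

End spectra.

(** * Patterns with positive probability *)

Section almost_sure.
Context d (Omega : measurableType d) (R : realType) (P : probability Omega R).

Lemma ae_probability1 (E : set Omega) :
  measurable E -> {ae P, forall om, E om} -> P E = 1%E.
Proof.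
move=> mE aeE; rewrite -(setCK E) probability_setC; last exact: measurableC.
rewrite (_ : P (~` E) = 0%E) ?sube0//.
exact: (measure_negligible (measurableC mE) aeE).
Qed.

Lemma ae_probability0 (E : set Omega) :
  measurable E -> {ae P, forall om, ~ E om} -> P E = 0%E.
Proof.
move=> mE aeE; apply: measure_negligible => //.
by apply: negligibleS aeE => om Eom /=; apply.
Qed.

Variable X : nat -> {RV P >-> R}.
Hypothesis hX : iid X.
Let Gamma := essran (X 0%N).

Lemma iid_rectangle_ae n (B : nat -> set R) (Q : Omega -> Prop) :
  {ae P, forall om, Q om} -> (forall i, measurable (B i)) ->
  (forall i, (i < n)%N -> (0 < P (X 0%N @^-1` B i))%E) ->
  exists2 om, Q om & forall i, (i < n)%N -> B i (X i om).
Proof.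
move=> aeQ mB B0; have := iid_rectangle_gt0 hX mB B0.
set E := [set _ | _] => E0; apply: contrapT => nE.
have mE : measurable E.
  rewrite (_ : E = \bigcap_(i in `I_n) (X i @^-1` B i)).
    by apply: bigcap_measurableType => i _; exact: measurable_funPTI.
  by rewrite eqEsubset; split=> om h i; apply: h.
move: E0; rewrite (ae_probability0 mE) ?ltxx//.
by apply: filterS aeQ => om Qom Eom; apply: nE; exists om.
Qed.

(** With positive probability the first [n] entries of [X] are within [eps] of
[v], nonzero before the last place, and different from [a k] at a place [k] where
[v] differs from [a]. The last property rules out that [X] begins like [a]. *)
Lemma window_limit_of_ae_match (a : nat -> R) n v :
  {ae P, forall om, block_matches (fun i => X i om) a} ->
  (forall i, (i < n)%N -> Gamma (v i)) ->
  (forall i, (i.+1 < n)%N -> v i != 0) ->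
  (exists2 i, (i < n)%N & v i != a i) -> window_limit a n v.
Proof.
move=> hTA vG v0 [k kn vk]; apply: window_limit_closed => eps eps0.
(* radii that keep the first entries off a at k and off 0 where needed *)
pose rad i := Order.min eps (Order.min `|v k - a k|
  (if (i.+1 < n)%N then `|v i| else eps)).
have rad0 i : 0 < rad i.
  rewrite /rad !lt_min eps0 normr_gt0 subr_eq0 vk /=.
  by case: ifP => // /v0; rewrite normr_gt0.
have [om hom XB] := @iid_rectangle_ae n (fun i => ball (v i) (rad i)) _ hTA
  (fun i => measurable_realfun.measurable_ball _ _)
  (fun i iN => essran_ball_gt0 (vG i iN) (rad0 i)).
have {}XB i : (i < n)%N -> [/\ `|X i om - v i| < eps,
    `|X i om - v i| < `|v k - a k| & (i.+1 < n)%N -> `|X i om - v i| < `|v i| ].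
  move=> iN; have := XB i iN; rewrite -ball_normE /= distrC /rad !lt_min.
  by move=> /and3P[-> -> h]; split=> // iN'; move: h; rewrite iN'.
have bp : block_prefix (fun i => X i om) 0 n.
  split=> [|i iN]; first by left.
  rewrite add0n; apply/eqP => Xi0; have [_ _ /(_ iN)] := XB i (ltnW iN).
  by rewrite Xi0 sub0r normrN ltxx.
have [W|aX] := hom _ _ bp.
  exists (fun i => X i om); last by move=> i /XB[].
  by apply: eq_window_limit W => i _; rewrite add0n.
have [_ + _] := XB k kn; rewrite -[X k om](aX k kn) distrC.
by rewrite ltxx.
Qed.

Lemma essran_ae_nonempty : exists c, Gamma c.
Proof.
have [om h _] := @iid_rectangle_ae 0 (fun=> setT) _ (ae_essran hX)
  (fun=> measurableT) (fun i (h : (i < 0)%N) => ltac:(by [])).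
by exists (X 0%N om); exact: h.
Qed.

Lemma essran_away0 : ~ Gamma 0 ->
  exists2 del, 0 < del & forall x, Gamma x -> del <= `|x|.
Proof.
move=> G0; have /nbhs_ballP[e /= e0 eG] : nbhs 0 (~` Gamma).
  by apply: open_nbhs_nbhs; split=> //; apply: closed_openC; exact: closed_essran.
exists e => // x xG; rewrite leNgt; apply/negP => xe; apply: (eG x) => //.
by rewrite -ball_normE /= sub0r normrN.
Qed.

(** No point carries more than [1 - p] of the mass, where [p] is the smaller of the
probabilities of two disjoint balls; so the first [k] entries of [X] agree with
[b] with probability at most [(1 - p)^k]. *)
Lemma ae_differs_from_sequence (b : nat -> R) u v : Gamma u -> Gamma v ->
  u != v -> {ae P, forall om, exists i, X i om != b i}.
Proof.
move=> uG vG uv.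
pose e := `|u - v| / 2; have e0 : 0 < e by rewrite divr_gt0// normr_gt0 subr_eq0.
(* every point misses one of the two disjoint balls of radius e *)
pose p := Order.min (fine (P (X 0%N @^-1` ball u e)))
  (fine (P (X 0%N @^-1` ball v e))).
have mb z : measurable (X 0%N @^-1` ball z e).
  by apply: measurable_funPTI; exact: measurable_realfun.measurable_ball.
have fin E : measurable E -> (fine (P E))%:E = P E.
  by move=> mE; rewrite fineK//; exact: fin_num_measure.
have p0 : 0 < p.
  rewrite /p lt_min -!lte_fin !fin//.
  by apply/andP; split; exact: essran_ball_gt0.
have mS (x : R) : measurable (X 0%N @^-1` [set x]) by exact: measurable_funPTI.
have le_p x : (P (X 0%N @^-1` [set x]) <= (1 - p)%:E)%E.
  have sub z : p <= fine (P (X 0%N @^-1` ball z e)) -> ~ ball z e x ->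
      (P (X 0%N @^-1` [set x]) <= (1 - p)%:E)%E.
    move=> pz zx; apply: (@le_trans _ _ (P (~` (X 0%N @^-1` ball z e)))).
      apply: le_measure; rewrite ?inE//; first exact: measurableC.
      by move=> om /= -> .
    by rewrite probability_setC// -fin// -EFinB lee_fin lerD2l lerN2.
  have [xu|] := pselect (ball u e x); last by apply: sub; rewrite ge_min lexx.
  apply: (sub v); first by rewrite ge_min lexx orbT.
  move: xu; rewrite -!ball_normE /= => xu xv.
  have : `|u - v| < e + e.
    have -> : u - v = (u - x) - (v - x) by ring.
    by rewrite (le_lt_trans (ler_normB _ _))// ltrD.
  by rewrite /e -splitr ltxx.
pose N := \bigcap_i (X i @^-1` [set b i]).
have mN : measurable N by apply: bigcapT_measurable => i; exact: measurable_funPTI.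
exists N; split=> //; last first.
  move=> om /= h i _ /=; apply: contrapT => hi; apply: h; exists i; exact/eqP.
have p1 : p <= 1.
  have := le_trans (measure_ge0 P _) (le_p 0); rewrite lee_fin; lra.
apply/eqP; rewrite eq_le measure_ge0 andbT; apply/lee_addgt0Pr => eps eps0.
have q1 : `|1 - p| < 1 by rewrite ger0_norm; lra.
have /cvgrPdist_lt/(_ eps eps0)[k _ /(_ k (leqnn k))] := cvg_expr q1.
rewrite /= sub0r normrN ger0_norm ?exprn_ge0//; last by lra.
move=> h; rewrite add0e; apply: (@le_trans _ _ ((1 - p) ^+ k)%:E); last first.
  by rewrite lee_fin ltW.
apply: (@le_trans _ _ (P (\bigcap_(j in [set` iota 0 k]) (X j @^-1` [set b j])))).
  apply: le_measure; rewrite ?inE//; last by move=> om h' j _; exact: h'.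
  by apply: bigcap_measurableType => i _; exact: measurable_funPTI.
rewrite iid_rectangle ?iota_uniq//.
move: (iota 0 k) (size_iota 0 k) => J; elim: J k {h} => [|j s IH] [|k]//=.
  by rewrite big_nil expr0.
move=> [] /IH hs; rewrite big_cons exprS EFinM; apply: lee_pmul => //.
by apply: prode_ge0 => i _; exact: measure_ge0.
Qed.

End almost_sure.

(** * Almost sure domination *)

Section deterministic.
Variable R : realType.
Implicit Types (a x v : nat -> R) (G : set R).

(** Every [a i] belongs to a piece starting at the beginning of its block, and is
therefore a limit of values of [x] or equal to one. *)
Lemma block_matches_closed a x G :
  closed G -> (forall i, G (x i)) -> block_matches a x -> forall i, G (a i).
Proof.
move=> cG xG ax i; have [s [sa si aN]] := last_block_start a i.+1.
have {}si : (s <= i)%N by case: si => [->|].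
have bp : block_prefix a s (i - s).+1.
  by split=> // k kn; apply: aN; [exact: leq_addr|lia].
apply: cG => B /nbhs_ballP[eps /= eps0 eB].
have [[W|W]] := (ax _ _ bp, I).
  have [j [_ /(_ (i - s)%N (leqnn _))]] := W _ eps0.
  rewrite subnKC// => h; exists (x (j.+1 + (i - s))%N); split; first exact: xG.
  by apply: eB; rewrite -ball_normE /= distrC.
have := W (i - s)%N (leqnn _); rewrite subnKC// => xa.
exists (a i); split; first by rewrite -xa.
by apply: eB; exact: ballxx.
Qed.

(** No window of [x] is preceded by a small weight, so every piece of [a] is a
beginning of [x]; as these are nonzero, the first block of [a] is all of [a]. *)
Lemma block_matches_bounded_below a x del :
  0 < del -> (forall i, del <= `|x i|) -> block_matches a x -> x = a.
Proof.
move=> del0 xd ax; suff H n : forall i, (i < n)%N -> x i = a i.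
  by apply/funext => i; exact: (H i.+1).
elim: n => // n IH i iN.
have [|W|W] := ax 0%N n.+1; last by rewrite W.
  split=> [|k kn]; first by left.
  rewrite add0n -IH//; apply/eqP => xk; have := xd k; rewrite xk normr0.
  by rewrite leNgt del0.
by have [j [xj _]] := W _ del0; have := xd j; rewrite leNgt xj.
Qed.

End deterministic.

Section random.
Context d (Omega : measurableType d) (R : realType) (P : probability Omega R).
Variables (X : nat -> {RV P >-> R}) (a : nat -> R).
Hypotheses (hX : iid X) (a0 : forall i, 0 <= a i).
Let Gamma := essran (X 0%N).
Let cG : closed Gamma := closed_essran (X := X).
Let path om := fun i => X i om.

(** Almost surely [X] has windows close to [(0, a_s, ..., a_(s+n-1))]. *)
Lemma ae_block_matches : Gamma 0 -> (forall i, Gamma (a i)) ->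
  {ae P, forall om, block_matches a (path om)}.
Proof.
move=> G0 aG.
have H s n k : {ae P, forall om, exists j, `|X j om| < k.+1%:R^-1 /\
    forall i, (i < n)%N -> `|X (j.+1 + i)%N om - a (s + i)%N| < k.+1%:R^-1}.
  have k0 : (0 : R) < k.+1%:R^-1 by rewrite invr_gt0.
  pose c i := if i is i'.+1 then a (s + i')%N else 0.
  have cGa i : Gamma (c i) by case: i => [|i]; [exact: G0|exact: aG].
  have := @iid_window_ae _ _ _ _ X hX 0 n.+1 (fun i => ball (c i) k.+1%:R^-1)
    (fun i => measurable_realfun.measurable_ball _ _)
    (fun i _ => essran_ball_gt0 (cGa i) k0).
  apply: filterS => om [m [_ h]]; exists m; split.
    by have := h 0%N isT; rewrite addn0 -ball_normE /= sub0r normrN.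
  by move=> i iN; have := h i.+1 iN; rewrite -ball_normE /= distrC addnS addSn.
have : {ae P, forall om, forall s n k, exists j, `|X j om| < k.+1%:R^-1 /\
    forall i, (i < n)%N -> `|X (j.+1 + i)%N om - a (s + i)%N| < k.+1%:R^-1}.
  apply: ae_foralln => s; apply: ae_foralln => n; apply: ae_foralln => k.
  exact: H.
apply: filterS => om h s n _; left => eps eps0.
have [k _ /(_ _ (leqnn k)) ke] := near_infty_natSinv_lt (PosNum eps0).
have [j [h1 h2]] := h s n k.
by exists j; split=> [|i /h2]; [apply: lt_trans ke|move/lt_trans; apply].
Qed.

Lemma ae_not_block_matches : ~ (forall i, Gamma (a i)) ->
  {ae P, forall om, ~ block_matches a (path om)}.
Proof.
move=> naG; apply: filterS (ae_essran hX) => om XG ax; apply: naG.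
exact: (block_matches_closed cG XG ax).
Qed.

Lemma essran_card1P : (Gamma #= `I_1)%card <-> exists c, Gamma = [set c].
Proof.
split=> [/eq_cardSP[c cG1]|[c ->]]; last exact: card_set1.
rewrite II0 card_eq0 => /eqP Gc; exists c.
rewrite eqEsubset; split=> [u uG|_ ->//].
by apply: contrapT => uc; have : (Gamma `\ c) u by []; rewrite Gc.
Qed.

Lemma ae_constant_path c : Gamma = [set c] -> (forall i, a i = c) ->
  {ae P, forall om, path om = a}.
Proof.
move=> Gc ac; apply: filterS (ae_essran hX) => om XG; apply/funext => i.
by have := XG i; rewrite -/Gamma Gc ac.
Qed.

(** [X] would have to equal [a]: impossible almost surely if [Gamma] has two
points, and excluded by hypothesis if it has one. *)
Lemma ae_not_block_matches_away0 : ~ Gamma 0 ->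
  ~ (exists2 c, Gamma = [set c] & forall i, a i = c) ->
  {ae P, forall om, ~ block_matches a (path om)}.
Proof.
move=> G0 nc; have [del del0 Gdel] := essran_away0 G0.
have ae_eq : {ae P, forall om, block_matches a (path om) -> path om = a}.
  apply: filterS (ae_essran hX) => om XG.
  by apply: (block_matches_bounded_below del0) => i; apply: Gdel; exact: XG.
have [c cGm] := essran_ae_nonempty hX.
have [Gc|nGc] := pselect (Gamma = [set c]).
  have [i ai] : exists i, a i <> c.
    by apply/existsNP => h; apply: nc; exists c.
  apply: filterS2 ae_eq (ae_essran hX) => om h XG /h Xa; apply: ai.
  by have := XG i; rewrite -/Gamma Gc -Xa.
have [u uG uc] : exists2 u, Gamma u & u != c.
  apply: contrapT => h; apply: nGc; rewrite eqEsubset; split=> [u uG|_ ->//].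
  by apply/eqP/negPn/negP => uc; apply: h; exists u.
apply: filterS2 ae_eq (ae_differs_from_sequence hX a uG cGm uc).
move=> om h [i Xi] /h Xa.
by move: Xi; rewrite -Xa eqxx.
Qed.

(** For nonzero [v] it is enough to extend [v] by nonzero points of [Gamma] to a
sequence different from [a]. If this is impossible then [Gamma] has a single
nonzero point, and [a] is constantly equal to it. Zero entries of [v] are limits
of nonzero points of [Gamma]. *)
Lemma window_limit_of_ae_matches : ~ Gamma 0 \/ limit_point Gamma 0 ->
  ~ (exists2 c, Gamma = [set c] & forall i, a i = c) ->
  {ae P, forall om, block_matches (path om) a} ->
  forall n, (0 < n)%N -> forall v, (forall i, (i < n)%N -> Gamma (v i)) ->
  window_limit a n v.
Proof.
move=> G0 nc hTA n n0.
have nonzero v : (forall i, (i < n)%N -> Gamma (v i)) ->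
    (forall i, (i < n)%N -> v i != 0) -> window_limit a n v.
  move=> vG vn0.
  suff [v' [v'v v'G v'0 [i v'a]]] : exists v' : nat -> R,
      [/\ forall i, (i < n)%N -> v' i = v i, forall i, Gamma (v' i),
          forall i, v' i != 0 & exists i, v' i != a i].
    apply: (eq_window_limit v'v); apply: (@window_limit_le _ _ _ (maxn n i.+1)).
      exact: leq_maxl.
    apply: (window_limit_of_ae_match hX hTA) => [k _|k _|].
    - exact: v'G.
    - exact: v'0.
    - by exists i => //; exact: leq_maxr.
  apply: contrapT => nv'.
  have ext (u : R) i : Gamma u -> u != 0 -> (n <= i)%N -> a i = u.
    move=> uG u0 ni; apply: contrapT => aiu; apply: nv'.
    exists (fun k => if (k < n)%N then v k else u); split.
    - by move=> k ->.
    - by move=> k; case: ifP => // /vG.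
    - by move=> k; case: ifP => // /vn0.
    - by exists i; rewrite ltnNge ni /=; apply/eqP => h; exact: aiu.
  pose c := a n.
  have G1 u : Gamma u -> u != 0 -> u = c by move=> uG u0; rewrite /c (ext u).
  have vc : v 0%N = c by apply: G1; [exact: vG|exact: vn0].
  have cGm : Gamma c by rewrite -vc; exact: vG.
  have c0 : c != 0 by rewrite -vc; exact: vn0.
  have ac i : a i = c.
    have [ni|iN] := leqP n i; first exact: ext.
    apply: contrapT => aic; apply: nv'.
    exists (fun k => if (k < n)%N then v k else c); split.
    - by move=> k ->.
    - by move=> k; case: ifP => // /vG.
    - by move=> k; case: ifP => // /vn0.
    - exists i => /=; rewrite iN (G1 _ (vG _ iN) (vn0 _ iN)).
      by apply/eqP => h; exact: aic.
  case: G0 => [G0|lim0].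
    apply: nc; exists c => //; rewrite eqEsubset; split=> [u uG|_ ->//].
    by apply: G1 => //; apply/eqP => u0; apply: G0; rewrite -u0.
  have [y [y0 yG]] := lim0 _ (nbhsx_ballx 0 `|c| (ltac:(by rewrite normr_gt0))).
  by rewrite (G1 y)// -ball_normE /= sub0r normrN ltxx.
move=> v vG; case: G0 => [G0|lim0].
  by apply: nonzero => // i iN; apply/eqP => vi; apply: G0; rewrite -vi; exact: vG.
apply: window_limit_closed => eps eps0.
have [y [y0 yG]] := lim0 _ (nbhsx_ballx 0 eps eps0).
rewrite -ball_normE /= sub0r normrN => ye.
exists (fun i => if v i == 0 then y else v i).
  apply: nonzero => i iN; case: ifPn => //; first by move=> _; exact: vG.
move=> i iN; case: eqP => [->|_]; first by rewrite subr0.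
by rewrite subrr normr0.
Qed.

Lemma ae_matches_of_window_limit :
  (forall n, (0 < n)%N -> forall v, (forall i, (i < n)%N -> Gamma (v i)) ->
     window_limit a n v) -> {ae P, forall om, block_matches (path om) a}.
Proof.
move=> H; apply: filterS (ae_essran hX) => om XG s n _; left.
apply: (@window_limit_le _ _ _ n.+1); first exact: leqnSn.
by apply: H => // i _; exact: XG.
Qed.

(** For nonzero [v], the description by windows of the domination of the truncated
shift with weights [v] by the shift with weights [a]. *)
Definition block_condition n v :=
  window_limit a n.+1 (pad0 n v) \/ (forall i, (i < n.+1)%N -> a i = pad0 n v i).

Lemma block_condition_of_ae_matches : Gamma 0 ->
  {ae P, forall om, block_matches (path om) a} ->
  forall n v, (forall i, (i < n)%N -> Gamma (v i)) ->
    (forall i, (i < n)%N -> v i != 0) -> block_condition n v.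
Proof.
move=> G0 hTA n v vG v0.
have [|naeq] := pselect (forall i, (i < n.+1)%N -> a i = pad0 n v i).
  by right.
left; apply: (window_limit_of_ae_match hX hTA).
- by move=> i _; rewrite /pad0; case: ifP => // /vG.
- by move=> i iN; rewrite /pad0 -ltnS iN v0.
- move/existsNP: naeq => [i /not_implyP[iN /eqP ai]]; exists i => //.
  by rewrite eq_sym.
Qed.

(** Zeros occur arbitrarily far out in [X], because near 0 the only point of
[Gamma] is 0 itself. Hence every piece of [X] that starts a block is contained in
a finite block closed by a zero. *)
Lemma ae_matches_of_block_condition : isolated Gamma 0 ->
  (forall n v, (forall i, (i < n)%N -> Gamma (v i)) ->
    (forall i, (i < n)%N -> v i != 0) -> block_condition n v) ->
  {ae P, forall om, block_matches (path om) a}.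
Proof.
move=> [/set_mem G0 [V /nbhs_ballP[del /= del0 delV] VG]] H.
have zeros s : {ae P, forall om, exists m, (s <= m)%N /\
    forall i, (i < 1)%N -> ball 0 del (X (m + i)%N om)}.
  exact: (@iid_window_ae _ _ _ _ X hX s 1 (fun=> ball 0 del)
    (fun i => measurable_realfun.measurable_ball _ _)
    (fun i _ => essran_ball_gt0 G0 del0)).
apply: filterS2 (ae_foralln zeros) (ae_essran hX) => om Z XG s n [sX Xn].
have ex0 : exists j, (s <= j)%N && (X j om == 0).
  have [m [sm /(_ 0%N isT)]] := Z s; rewrite addn0 => /delV Vm.
  exists m; rewrite sm /=; apply/eqP.
  have : (V `&` Gamma) (X m om) by split => //; exact: XG.
  by rewrite VG.
have [j /andP[sj /eqP Xj] jmin] := ex_minnP ex0.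
pose v i := X (s + i)%N om.
have vj i : (i < j - s)%N -> v i != 0.
  move=> ij; apply/negP => vi; have := jmin (s + i)%N.
  by rewrite leq_addr vi => /(_ isT); lia.
have nj : (n <= (j - s).+1)%N.
  rewrite leqNgt; apply/negP => h; have := Xn (j - s)%N h.
  by rewrite /path subnKC// Xj eqxx.
have padE i : (i < n)%N -> pad0 (j - s) v i = X (s + i)%N om.
  move=> iN; rewrite /pad0; case: ltnP => // ji.
  have -> : i = (j - s)%N by lia.
  by rewrite subnKC.
have [W|W] := H (j - s)%N v (fun i _ => XG _) vj.
  by left; apply: (eq_window_limit padE); exact: window_limit_le W.
by right=> i iN; rewrite W ?padE//; apply: leq_trans nj.
Qed.

End random.

(** * Blocks when zero is isolated *)

Section isolated_zero.
Variables (R : realType) (a : nat -> R) (G : set R).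
Hypothesis a0 : forall i, 0 <= a i.
Let G1 := G `\ 0.
Let framed n (V : set 'rV[R]_n) := row_prod row_zero (row_prod V row_zero).

Lemma row_power_rowP n (v : nat -> R) :
  row_power G1 n (\row_j v j) <-> forall i, (i < n)%N -> G1 (v i).
Proof.
split=> [h i iN|h j]; last by rewrite mxE; exact: h.
by have := h (Ordinal iN); rewrite mxE.
Qed.

Lemma row_window n (v : nat -> R) :
  \row_j v j = window a 0 n <-> forall i, (i < n)%N -> a i = v i.
Proof.
split=> [h i iN|h]; last by apply/rowP => j; rewrite !mxE add0n h.
by have := congr1 (fun u : 'rV_n => u 0 (Ordinal iN)) h; rewrite !mxE.
Qed.

Lemma window_in_framed m :
  row_prod (row_power G1 m) row_zero (window a 0 (m + 1)) <->
  (forall i, (i < m)%N -> G1 (a i)) /\ a m = 0.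
Proof.
split=> [[u uG [_ -> uE]]|[aG am]].
  have uEi j := congr1 (fun u : 'rV_(m + 1) => u 0 j) uE.
  split=> [i im|].
    have := uEi (lshift 1 (Ordinal im)); rewrite row_mxEl !mxE /= => <-; exact: uG.
  by have := uEi (rshift m 0); rewrite row_mxEr !mxE /= addn0.
exists (\row_j a j); first exact/row_power_rowP.
exists 0 => //; apply/rowP => j; rewrite [RHS]mxE add0n.
case: (splitP j) => k jk.
  by rewrite (_ : j = lshift 1 k) ?row_mxEl ?mxE//; exact: val_inj.
rewrite (_ : j = rshift m k) ?row_mxEr ?mxE; last exact: val_inj.
by rewrite ord1 /= addn0 am.
Qed.

Lemma prefix_pad0 n (v : nat -> R) :
  (forall i, (i < n.+1)%N -> a i = pad0 n v i) <->
  (forall i, (i < n)%N -> a i = v i) /\ a n = 0.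
Proof.
split=> [h|[h an] i]; last first.
  rewrite ltnS leq_eqVlt => /predU1P[->|iN]; first by rewrite /pad0 ltnn.
  by rewrite /pad0 iN h.
split=> [i iN|]; last by rewrite h// /pad0 ltnn.
by rewrite (h i (ltnW iN)) /pad0 iN.
Qed.

(** The block with which [a] begins is the only one for which the second
alternative of [block_condition] can hold: it is empty in the first case and
has length [m] in the third; in the second it satisfies the first alternative,
or [a] does not begin with such a block. *)
Lemma block_condition_cases :
  (forall n (v : nat -> R), (forall i, (i < n)%N -> G (v i)) ->
     (forall i, (i < n)%N -> v i != 0) -> block_condition a n v) <->
  [\/ a 0%N = 0 /\
      (forall n : nat, (1 <= n)%N ->
         framed (row_power G1 n) `<=` n_spectrum a (1 + (n + 1))),
      a 0%N != 0 /\
      (forall n : nat,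
         framed (row_power G1 n) `<=` n_spectrum a (1 + (n + 1)))
    | exists m : nat,
      [/\ (1 <= m)%N,
          row_prod (row_power G1 m) row_zero (window a 0 (m + 1)),
          framed (row_power G1 m `\ window a 0 m)
            `<=` n_spectrum a (1 + (m + 1))
        & forall n : nat, n <> m ->
            framed (row_power G1 n) `<=` n_spectrum a (1 + (n + 1))]].
Proof.
split=> [C|C n v vG vn0].
  have {}C n (v : nat -> R) : row_power G1 n (\row_j v j) ->
      window_limit a n.+1 (pad0 n v) \/
      [/\ forall i, (i < n)%N -> a i = v i, a n = 0 &
          forall i, (i < n)%N -> G1 (a i)].
    move=> /row_power_rowP vG1.
    have [|i iN||/prefix_pad0[h1 h2]] := C n v; [by move=> i /vG1[]| |by left|].
      by apply/eqP; have [] := vG1 _ iN.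
    by right; split=> // i iN; rewrite h1//; exact: vG1.
  have [a00|a00] := eqVneq (a 0%N) 0.
    constructor 1; split=> // n n0; apply/framed_subset => // v /C[//|[_ _ h]].
    by have [_] := h _ n0.
  have [[m [m1 [aG am]]]|nm] := pselect (exists m, (0 < m)%N /\
      (forall i, (i < m)%N -> G1 (a i)) /\ a m = 0).
    constructor 3; exists m; split=> //; first exact/window_in_framed.
      apply/framed_subset => // v [/C[//|[h _ _]] nw].
      by case: nw; apply/row_window.
    move=> n nm; apply/framed_subset => // v /C[//|[_ an h]].
    have [mn|mn|//] := ltngtP n m.
      by have [_] := aG _ mn.
    by have [_] := h _ mn.
  constructor 2; split=> // n; apply/framed_subset => // v /C[//|[_ an h]].
  have [n0|n0] := posnP n; first by rewrite n0 in an; rewrite an eqxx in a00.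
  by case: nm; exists n.
have vG1 : row_power G1 n (\row_j v j).
  by apply/row_power_rowP => i iN; split; [exact: vG|exact/eqP/vn0].
case: C => [[a00 C]|[_ C]|[m [m1 /window_in_framed[_ am] Cm C]]].
- case: n v vG vn0 vG1 => [|n] v vG vn0 vG1.
    by right; apply/prefix_pad0.
  by left; apply: (framed_subset _ a0).1 vG1; exact: C.
- by left; apply: (framed_subset _ a0).1 vG1; exact: C.
have [nm|nm] := eqVneq n m; last first.
  by left; apply: (framed_subset _ a0).1 vG1; apply: C; exact/eqP.
subst n; have [E|nE] := pselect (\row_j v j = window a 0 m).
  by right; apply/prefix_pad0; split=> //; exact/row_window.
by left; apply: (framed_subset _ a0).1; [exact: Cm|split].
Qed.

End isolated_zero.

(** * Random weighted shifts *)

Local Close Scope complex_scope.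

Theorem theorem6p3 (R : realType)
    (H : hilbertType R) (e : nat -> H) (he : orthonormal_basis e)
    (d : measure_display) (Omega : measurableType d) (P : probability Omega R)
    (X : nat -> {RV P >-> R})
    (hX0 : forall n om, 0 <= X n om)
    (hXb : forall n, exists M : R, forall om, X n om <= M)
    (hX : iid X)
    (T : Omega -> H -> H)
    (hT : forall om, weighted_shift e (fun n => X n om) (T om))
    (K : hilbertType R) (f : nat -> K) (hf : orthonormal_basis f)
    (a : nat -> R) (ha0 : forall i, 0 <= a i)
    (A : K -> K) (hA : weighted_shift f a A) :
  let Gamma := essran (X 0%N) in
  let Gamma1 := Gamma `\ 0 in
  let Sigma := n_spectrum a in
  let framed := fun (n : nat) (V : set 'rV[R]_n) =>
    row_prod row_zero (row_prod V row_zero) in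
  (* (i) *)
  (Gamma 0 ->
     (Sigma 1%N `<=` row_power Gamma 1 ->
        P [set om | lhd_op A (T om)] = 1%E) /\
     (~ (Sigma 1%N `<=` row_power Gamma 1) ->
        P [set om | lhd_op A (T om)] = 0%E)) /\
  (* (ii) *)
  (~ Gamma 0 ->
     ((Gamma #= `I_1)%card /\ Sigma 1%N = row_power Gamma 1 ->
        P [set om | lhd_op A (T om)] = 1%E) /\
     (~ ((Gamma #= `I_1)%card /\ Sigma 1%N = row_power Gamma 1) ->
        P [set om | lhd_op A (T om)] = 0%E)) /\
  (* (iii) *)
  (~ Gamma 0 \/ limit_point Gamma 0 ->
     ~ ((Gamma #= `I_1)%card /\ Sigma 1%N = row_power Gamma 1) ->
     ({ae P, forall om, lhd_op (T om) A} <->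
      forall n : nat, (1 <= n)%N ->
        row_prod row_zero (row_power Gamma n) `<=` Sigma (1 + n)%N)) /\
  (* (iv) *)
  (isolated Gamma 0 ->
     ({ae P, forall om, lhd_op (T om) A} <->
      [\/ a 0%N = 0 /\
          (forall n : nat, (1 <= n)%N ->
             framed n (row_power Gamma1 n) `<=` Sigma (1 + (n + 1))%N),
          a 0%N != 0 /\
          (forall n : nat,
             framed n (row_power Gamma1 n) `<=` Sigma (1 + (n + 1))%N)
        | exists m : nat,
          [/\ (1 <= m)%N,
              row_prod (row_power Gamma1 m) row_zero (window a 0 (m + 1)),
              framed m (row_power Gamma1 m `\ window a 0 m)
                `<=` Sigma (1 + (m + 1))%N
            & forall n : nat, n <> m ->
                framed n (row_power Gamma1 n) `<=` Sigma (1 + (n + 1))%N]])).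
Proof.
move=> Gamma Gamma1 Sigma framed.
have cG : closed Gamma := @closed_essran _ _ _ _ X.
have AT om : lhd_op A (T om) <-> block_matches a (fun i => X i om).
  by apply: (lhd_block_matches hf hA he (hT om)).
have TA om : lhd_op (T om) A <-> block_matches (fun i => X i om) a.
  by apply: (lhd_block_matches he (hT om) hf hA).
have ATE : [set om | lhd_op A (T om)] =
    [set om | block_matches a (fun i => X i om)].
  by rewrite eqEsubset; split=> om /AT.
have TAae : {ae P, forall om, lhd_op (T om) A} <->
    {ae P, forall om, block_matches (fun i => X i om) a}.
  by split; apply: filterS => om /TA.
have mAT : measurable [set om | block_matches a (fun i => X i om)].
  exact: measurable_block_matches.
have constP : (Gamma #= `I_1)%card /\ Sigma 1%N = row_power Gamma 1 <->
    exists2 c, Gamma = [set c] & forall i, a i = c.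
  split=> [[/essran_card1P[c Gc] S1]|[c Gc ac]].
    have /(spectrum1_subset ha0 cG) aG : Sigma 1%N `<=` row_power Gamma 1.
      by rewrite S1.
    exists c => // i; suff: [set c] (a i) by [].
    by rewrite -Gc; exact: aG.
  split; first by apply/essran_card1P; exists c.
  rewrite eqEsubset; split.
    apply/(spectrum1_subset ha0 cG) => i.
    by rewrite -/(Gamma _) (_ : Gamma = [set c])//; exact: ac.
  move=> u uG; apply/n_spectrumP => // eps eps0; exists 0%N => j.
  have uc : [set c] (u 0 j) by rewrite -Gc; exact: uG.
  by rewrite ac uc subrr normr0.
rewrite ATE; split; [|split; [|split]].
- move=> G0; split=> [/(spectrum1_subset ha0 cG) aG|naG].
    by apply: ae_probability1 => //; exact: ae_block_matches.
  apply: ae_probability0 => //; apply: ae_not_block_matches => //.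
  by move=> aG; apply: naG; apply/(spectrum1_subset ha0 cG).
- move=> G0; split=> [/constP[c Gc ac]|nc].
    apply: ae_probability1 => //; apply: filterS (ae_constant_path hX Gc ac).
    move=> om /= Xa s n _; right=> i _.
    by rewrite (congr1 (fun x => x i) Xa) !ac.
  apply: ae_probability0 => //.
  by apply: ae_not_block_matches_away0 => // /constP.
- move=> G0 nc; apply: (iff_trans TAae); split=> [hTA n n0|h].
    apply/row_zero_subset => //; apply: window_limit_of_ae_matches n n0 => //.
    by move=> /constP.
  apply: ae_matches_of_window_limit => // n n0.
  by apply/(row_zero_subset _ _ ha0); exact: h.
- move=> G0; apply: (iff_trans TAae).
  apply: (iff_trans _ (block_condition_cases _ ha0)).
  split=> h.
    apply: block_condition_of_ae_matches h => //; exact/set_mem/G0.1.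
  exact: ae_matches_of_block_condition.
Qed.
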